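(* Let $R$ be a commutative ring with unity and let $\varphi:\mathcal{C}\to\mathcal{D}$ be a functor between two small categories. For every coefficient system $M:\Delta(N\mathcal{C})\to R\text{-Mod}$ there is a first-quadrant (cohomological) spectral sequence $$E_2^{p,q}=H^p\bigl(\mathcal{D}^{op};\,H^q_{Th}(\varphi/-;\,j^*M)\bigr)\;\Longrightarrow\;H^{p+q}_{Th}(\mathcal{C};M),$$ where for each object $d$ of $\mathcal{D}$, $j:\varphi/d\to\mathcal{C}$ is the forgetful functor that sends each object $(c,\mu)$ to $c$.
   Context: For an object $d$ of $\mathcal{D}$, $\varphi/d$ is the comma category with objects $(c,\mu:\varphi(c)\to d)$ and morphisms $(c,\mu)\to(c',\mu')$ the $\alpha:c\to c'$ in $\mathcal{C}$ with $\mu'\varphi(\alpha)=\mu$. A morphism $\beta:d\to d'$ of $\mathcal{D}$ induces the functor $\beta_*:\varphi/d\to\varphi/d'$, $(c,\mu)\mapsto(c,\beta\mu)$, and $j\circ\beta_*=j$. For a simplicial set $X$, the category of simplices $\Delta(X)$ has objects $([n],\sigma)$ with $\sigma\in X_n$ (written simply $\sigma$), and morphisms $([m],\tau)\to([n],\sigma)$ are the morphisms $f:[m]\to[n]$ of the simplex category $\Delta$ with $f^*\sigma=\tau$. A coefficient system on $X$ is a functor $M:\Delta(X)\to R\text{-Mod}$. Let $C(X;M)$ be the cosimplicial $R$-module with $C^n(X;M)=\prod_{\sigma\in X_n}M(\sigma)$ and, for $f:[m]\to[n]$, $(f^*\zeta)(\sigma)=M(f)(\zeta(f^*\sigma))$.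 The Gabriel-Zisman cohomology $H^\bullet(X;M)$ is the cohomology of $C(X;M)$, i.e. of the cochain complex with differential the alternating sum of the coface maps. For a small category $\mathcal{C}$ and a coefficient system $M$ on its nerve $N\mathcal{C}$, the Thomason cohomology is $H^\bullet_{Th}(\mathcal{C};M):=H^\bullet(N\mathcal{C};M)$. A functor $\psi:\mathcal{A}\to\mathcal{B}$ pulls a coefficient system $M$ on $N\mathcal{B}$ back to $\psi^*M=M\circ\Delta(N\psi)$ on $N\mathcal{A}$, where $\Delta(N\psi):\Delta(N\mathcal{A})\to\Delta(N\mathcal{B})$ is the functor induced by $N\psi$; the cochain map $(\psi^*\zeta)(\sigma)=\zeta(N\psi(\sigma))$ induces $\psi^*:H^\bullet_{Th}(\mathcal{B};M)\to H^\bullet_{Th}(\mathcal{A};\psi^*M)$. $H^q_{Th}(\varphi/-;j^*M):\mathcal{D}^{op}\to R\text{-Mod}$ is the functor $d\mapsto H^q_{Th}(\varphi/d;j^*M)$, with a morphism $\beta:d\to d'$ of $\mathcal{D}$ acting by $(\beta_* )^*:H^q_{Th}(\varphi/d';j^*M)\to H^q_{Th}(\varphi/d;j^*M)$. For a small category $\mathcal{E}$, an $R\mathcal{E}$-module is a functor $A:\mathcal{E}\to R\text{-Mod}$ (these form an abelian category with objectwise exactness), and $H^p(\mathcal{E};A):=\operatorname{Ext}^p_{R\mathcal{E}}(\underline{R},A)$, where $\underline{R}$ is the constant functor with value $R$. *)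

(* Defs.v *)
From HB Require Import structures.
From mathcomp Require Import all_boot all_order all_algebra.
From mathcomp Require Import boolp zify.

Set Implicit Arguments.
Unset Strict Implicit.
Unset Printing Implicit Defensive.

Import GRing.Theory.
Local Open Scope ring_scope.

(* There is a single, monomorphic universe level for objects and one for
   morphisms, bounded by the level of the carriers of R-modules (products of
   modules indexed by simplices are formed below): the values of [category] are
   the small categories.  Functors to the large category R-Mod have their own
   record [rmod]. *)
Record category := Category {
  Ob :> Type;
  Hom : Ob -> Ob -> Type;
  idc : forall a, Hom a a;
  comp : forall a b c, Hom b c -> Hom a b -> Hom a c;
  comp1f : forall a b (f : Hom a b), comp (idc b) f = f;
  compf1 : forall a b (f : Hom a b), comp f (idc a) = f;
  compA : forall a b c d (h : Hom c d) (g : Hom b c) (f : Hom a b),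
    comp h (comp g f) = comp (comp h g) f }.

Arguments Hom {_}.
Arguments idc {_}.
Arguments comp {_ _ _ _}.

Definition op (C : category) : category :=
  @Category C (fun a b => @Hom C b a) (@idc C) (fun a b c g f => comp f g)
    (fun a b f => compf1 f) (fun a b f => comp1f f)
    (fun a b c d h g f => esym (compA f g h)).

Record functor (C D : category) := Functor {
  fob :> C -> D;
  fmap : forall a b, Hom a b -> Hom (fob a) (fob b);
  fmap_id : forall a, fmap (idc a) = idc (fob a);
  fmap_comp : forall a b c (g : Hom b c) (f : Hom a b),
    fmap (comp g f) = comp (fmap g) (fmap f) }.

Arguments fmap {C D} _ {a b}.

Lemma functor_eq (C D : category) (o : C -> D)
    (m1 m2 : forall a b, Hom a b -> Hom (o a) (o b)) i1 i2 c1 c2 :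
  (forall a b (f : Hom a b), m1 a b f = m2 a b f) ->
  @Functor C D o m1 i1 c1 = @Functor C D o m2 i2 c2.
Proof.
move=> e; have em : m1 = m2.
  by apply: functional_extensionality_dep => a;
     apply: functional_extensionality_dep => b; apply/funext.
by subst m2; congr Functor; apply: Prop_irrelevance.
Qed.

Definition hom_cast (C : category) (a a' b b' : C) (ea : a = a') (eb : b = b')
  (f : Hom a b) : Hom a' b' :=
  match ea in _ = x, eb in _ = y return Hom x y with erefl, erefl => f end.

Lemma functor_ext (C D : category) (F G : functor C D)
    (eo : forall a, F a = G a) :
  (forall a b (f : Hom a b), hom_cast (eo a) (eo b) (fmap F f) = fmap G f) ->
  F = G.
Proof.
case: F G eo => [o m i c] [o' m' i' c'] /= eo em.
have e : o = o' by apply: functional_extensionality_dep.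
subst o'; apply: functor_eq => a b f; rewrite -em.
by rewrite (Prop_irrelevance (eo a) erefl) (Prop_irrelevance (eo b) erefl).
Qed.

Definition fcomp (A B C : category) (G : functor B C) (F : functor A B) :
  functor A C.
Proof.
refine (@Functor A C (fun a => G (F a)) (fun a b f => fmap G (fmap F f)) _ _).
- by move=> a; rewrite !fmap_id.
- by move=> a b c g f; rewrite !fmap_comp.
Defined.

Section Comma.
Variables (C D : category) (phi : functor C D).

Definition comma_ob (d : D) := {c : C & Hom (phi c) d}.

Definition comma_hom d (x y : comma_ob d) :=
  {alpha : Hom (projT1 x) (projT1 y) |
     comp (projT2 y) (fmap phi alpha) = projT2 x}.

Fact comma_id_subproof d (x : comma_ob d) :
  comp (projT2 x) (fmap phi (idc (projT1 x))) = projT2 x.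
Proof. by rewrite fmap_id compf1. Qed.

Fact comma_comp_subproof d (x y z : comma_ob d)
    (g : comma_hom y z) (f : comma_hom x y) :
  comp (projT2 z) (fmap phi (comp (sval g) (sval f))) = projT2 x.
Proof. by rewrite fmap_comp compA (svalP g) (svalP f). Qed.

Definition comma (d : D) : category.
Proof.
refine (@Category (comma_ob d) (@comma_hom d)
  (fun x => exist _ _ (comma_id_subproof x))
  (fun x y z g f => exist _ _ (comma_comp_subproof g f)) _ _ _).
- by move=> x y [f ef]; apply: eq_exist; rewrite comp1f.
- by move=> x y [f ef]; apply: eq_exist; rewrite compf1.
- by move=> x y z t [h eh] [g eg] [f ef]; apply: eq_exist; rewrite compA.
Defined.

Definition comma_forget (d : D) : functor (comma d) C :=
  @Functor (comma d) C (fun x => projT1 x) (fun x y f => sval f)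
    (fun=> erefl) (fun _ _ _ _ _ => erefl).

Lemma functor_to_comma_ext (A : category) (d : D) (F G : functor A (comma d))
    (ep : forall a, projT1 (F a) = projT1 (G a)) :
  (forall a, F a = G a) ->
  (forall a b (f : Hom a b),
    hom_cast (ep a) (ep b) (sval (fmap F f)) = sval (fmap G f)) ->
  F = G.
Proof.
move=> eo em; apply: (functor_ext (eo := eo)) => a b f; have := em a b f.
rewrite (Prop_irrelevance (ep a) (congr1 (@projT1 _ _) (eo a))).
rewrite (Prop_irrelevance (ep b) (congr1 (@projT1 _ _) (eo b))).
move: (eo a) (eo b) (fmap F f) (fmap G f) => ea eb.
case: _ / ea; case: _ / eb => -[u eu] [v ev] /= euv.
exact: eq_exist.
Qed.

Section CommaPush.
Variables (d d' : D) (beta : Hom d d').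

Definition comma_push_ob (x : comma d) : comma d' :=
  existT _ (projT1 x) (comp beta (projT2 x)).

Fact comma_push_subproof (x y : comma d) (f : Hom x y) :
  comp (projT2 (comma_push_ob y)) (fmap phi (sval f)) =
  projT2 (comma_push_ob x).
Proof. by rewrite /= -compA (svalP f). Qed.

Definition comma_push : functor (comma d) (comma d').
Proof.
refine (@Functor (comma d) (comma d') comma_push_ob
  (fun x y f => exist _ (sval f) (comma_push_subproof f)) _ _).
- by move=> x; apply: eq_exist.
- by move=> x y z g f; apply: eq_exist.
Defined.

End CommaPush.

Lemma comma_push_id (A : category) (d : D) (s : functor A (comma d)) :
  fcomp (comma_push (idc d)) s = s.
Proof.
apply: (@functor_to_comma_ext A d (fcomp (comma_push (idc d)) s) s
          (fun=> erefl)) => // a.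
by rewrite /= /comma_push_ob comp1f; case: (s a).
Qed.

Lemma comma_push_comp (A : category) (d d' d'' : D)
    (g : Hom d' d'') (f : Hom d d') (s : functor A (comma d)) :
  fcomp (comma_push (comp g f)) s =
  fcomp (comma_push g) (fcomp (comma_push f) s).
Proof.
apply: (@functor_to_comma_ext A d'' (fcomp (comma_push (comp g f)) s)
          (fcomp (comma_push g) (fcomp (comma_push f) s)) (fun=> erefl)) => // a.
by rewrite /= /comma_push_ob /= compA.
Qed.

End Comma.

(* The object [n] = {0 < ... < n} of the simplex category is n. *)
Definition monotone (m n : nat) (f : 'I_m.+1 -> 'I_n.+1) : Prop :=
  {homo f : i j / (i <= j)%N}.

Definition delta_hom (m n : nat) := {f : 'I_m.+1 -> 'I_n.+1 | monotone f}.

Fact delta_id_subproof n : monotone (@id 'I_n.+1).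
Proof. by []. Qed.

Fact delta_comp_subproof m n p (g : delta_hom n p) (f : delta_hom m n) :
  monotone (sval g \o sval f).
Proof. by move=> i j /(svalP f) /(svalP g). Qed.

Definition Delta : category.
Proof.
refine (@Category nat delta_hom
  (fun n => exist _ _ (@delta_id_subproof n))
  (fun m n p g f => exist _ _ (delta_comp_subproof g f)) _ _ _).
- by move=> m n [f hf]; apply: eq_exist.
- by move=> m n [f hf]; apply: eq_exist.
- by move=> m n p q [h hh] [g hg] [f hf]; apply: eq_exist.
Defined.

Fact coface_subproof n (i : 'I_n.+2) : monotone (lift i).
Proof.
move=> j k jk; rewrite /= /bump leq_add //; case: (leqP i j) => //= ij.
by rewrite (leq_trans ij jk).
Qed.

Definition coface (n : nat) (i : 'I_n.+2) : @Hom Delta n n.+1 :=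
  exist _ _ (coface_subproof i).

Record sset := SSet {
  simp :> nat -> Type;
  smap : forall m n, @Hom Delta m n -> simp n -> simp m;
  smap_id : forall n s, smap (idc (n : Delta)) s = s;
  smap_comp : forall m n p (g : @Hom Delta n p) (f : @Hom Delta m n) s,
    smap (comp g f) s = smap f (smap g s) }.

Arguments smap X {m n} : rename.

Record sset_map (X Y : sset) := SSetMap {
  smor :> forall n, X n -> Y n;
  smorP : forall m n (f : @Hom Delta m n) (s : X n),
    smor (smap X f s) = smap Y f (smor s) }.

Arguments smor {X Y} _ {n}.

(* Linear order [n] as a category; a morphism i -> j is a proof of i <= j. *)
Definition ordcat (n : nat) : category :=
  @Category 'I_n.+1 (fun i j => is_true (i <= j)%N) (fun i => leqnn i)
    (fun i j k g f => leq_trans f g)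
    (fun _ _ _ => bool_irrelevance _ _) (fun _ _ _ => bool_irrelevance _ _)
    (fun _ _ _ _ _ _ _ => bool_irrelevance _ _).

Definition ordfunctor (m n : nat) (f : @Hom Delta m n) :
  functor (ordcat m) (ordcat n) :=
  @Functor (ordcat m) (ordcat n) (sval f) (fun i j => svalP f i j)
    (fun _ => bool_irrelevance _ _) (fun _ _ _ _ _ => bool_irrelevance _ _).

Definition nerve (C : category) : sset.
Proof.
refine (@SSet (fun n => functor (ordcat n) C)
          (fun m n f s => fcomp s (ordfunctor f)) _ _).
- move=> n [o m i c]; apply: functor_eq => a b f /=.
  by congr m; apply: bool_irrelevance.
- move=> m n p g f s; apply: functor_eq => a b h /=.
  by congr (fmap s); apply: bool_irrelevance.
Defined.

Definition nerve_map (A B : category) (psi : functor A B) :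
  sset_map (nerve A) (nerve B).
Proof.
by exists (fun n (s : nerve A n) => fcomp psi s) => m n f s; apply: functor_eq.
Defined.

Section Simplices.
Variable X : sset.

Definition simplices_ob := {n : nat & X n}.

Definition simplices_hom (t s : simplices_ob) :=
  {f : @Hom Delta (projT1 t) (projT1 s) | smap X f (projT2 s) = projT2 t}.

Fact simplices_comp_subproof t s r
    (g : simplices_hom s r) (f : simplices_hom t s) :
  smap X (comp (sval g) (sval f)) (projT2 r) = projT2 t.
Proof. by rewrite smap_comp (svalP g) (svalP f). Qed.

Definition simplices : category.
Proof.
refine (@Category simplices_ob simplices_hom
  (fun s => exist _ _ (smap_id (projT2 s)))
  (fun t s r g f => exist _ _ (simplices_comp_subproof g f)) _ _ _).
- by move=> t s [f ef]; apply: eq_exist; rewrite comp1f.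
- by move=> t s [f ef]; apply: eq_exist; rewrite compf1.
- by move=> t s r u [h eh] [g eg] [f ef]; apply: eq_exist; rewrite compA.
Defined.

End Simplices.

Definition simplex (X : sset) (n : nat) (s : X n) : simplices X := existT _ n s.

Section SimplicesMap.
Variables (X Y : sset) (h : sset_map X Y).

Definition simplices_map_ob (s : simplices X) : simplices Y :=
  simplex (h _ (projT2 s)).

Fact simplices_map_subproof (t s : simplices X) (f : Hom t s) :
  smap Y (sval f) (projT2 (simplices_map_ob s)) = projT2 (simplices_map_ob t).
Proof. by rewrite /= -smorP (svalP f). Qed.

Definition simplices_map : functor (simplices X) (simplices Y).
Proof.
refine (@Functor (simplices X) (simplices Y) simplices_map_ob
  (fun t s f => exist _ (sval f) (simplices_map_subproof f)) _ _).
- by move=> s; apply: eq_exist.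
- by move=> t s r g f; apply: eq_exist.
Defined.

End SimplicesMap.

(* The morphism f : (m, f^*s) -> (n, s) of Delta(X). *)
Definition simplices_lift (X : sset) (m n : nat) (f : @Hom Delta m n) (s : X n) :
  Hom (simplex (smap X f s)) (simplex s) := exist _ f erefl.

(* The identity of [n], as a morphism between equal n-simplices. *)
Definition simplices_eq (X : sset) (n : nat) (t s : X n) (e : t = s) :
  Hom (simplex t) (simplex s) :=
  exist _ (idc (n : Delta)) (etrans (smap_id s) (esym e)).

Section Modules.
Variable R : comPzRingType.
Implicit Types U V W : lmodType R.

Record lin_iso U V := LinIso {
  lin_iso_map :> {linear U -> V};
  lin_iso_bij : bijective lin_iso_map }.

Section Product.
Variables (I : Type) (V : I -> lmodType R).

Definition dprod := forall i, V i.
HB.instance Definition _ := gen_eqMixin dprod.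
HB.instance Definition _ := gen_choiceMixin dprod.

Let dprod_ext (x y : dprod) : (forall i, x i = y i) -> x = y.
Proof. exact: functional_extensionality_dep. Qed.

Let dprod0 : dprod := fun=> 0.
Let dprodN (x : dprod) : dprod := fun i => - x i.
Let dprodD (x y : dprod) : dprod := fun i => x i + y i.
Let dprodZ a (x : dprod) : dprod := fun i => a *: x i.

Fact dprodDA : associative dprodD.
Proof. by move=> x y z; apply: dprod_ext => i; apply: addrA. Qed.
Fact dprodDC : commutative dprodD.
Proof. by move=> x y; apply: dprod_ext => i; apply: addrC. Qed.
Fact dprod0D : left_id dprod0 dprodD.
Proof. by move=> x; apply: dprod_ext => i; apply: add0r. Qed.
Fact dprodND : left_inverse dprod0 dprodN dprodD.
Proof. by move=> x; apply: dprod_ext => i; apply: addNr. Qed.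
HB.instance Definition _ :=
  GRing.isZmodule.Build dprod dprodDA dprodDC dprod0D dprodND.

Fact dprodZA a b x : dprodZ a (dprodZ b x) = dprodZ (a * b) x.
Proof. by apply: dprod_ext => i; apply: scalerA. Qed.
Fact dprod1Z : left_id 1 dprodZ.
Proof. by move=> x; apply: dprod_ext => i; apply: scale1r. Qed.
Fact dprodZDr : right_distributive dprodZ +%R.
Proof. by move=> a x y; apply: dprod_ext => i; apply: scalerDr. Qed.
Fact dprodZDl v : {morph dprodZ^~ v : a b / a + b}.
Proof. by move=> a b; apply: dprod_ext => i; apply: scalerDl. Qed.
HB.instance Definition _ :=
  GRing.Zmodule_isLmodule.Build R dprod dprodZA dprod1Z dprodZDr dprodZDl.

Lemma dprodP (x y : dprod) : (forall i, x i = y i) -> x = y.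
Proof. exact: dprod_ext. Qed.

End Product.

Section Submodules.
Variables (U V : lmodType R).

Definition full_sub : {pred V} := predT.
Fact full_sub_submod : submod_closed full_sub.
Proof. by []. Qed.
HB.instance Definition _ := GRing.isSubmodClosed.Build R V full_sub full_sub_submod.

Definition zero_sub : {pred V} := pred1 0.
Fact zero_sub_submod : submod_closed zero_sub.
Proof.
split; first by rewrite inE.
by move=> a x y; rewrite !inE => /eqP -> /eqP ->; rewrite scaler0 addr0.
Qed.
HB.instance Definition _ := GRing.isSubmodClosed.Build R V zero_sub zero_sub_submod.

Definition ker (f : {linear U -> V}) : {pred U} := [pred x | f x == 0].
Fact ker_submod f : submod_closed (ker f).
Proof.
split; first by rewrite inE linear0.
move=> a x y; rewrite !inE => /eqP ex /eqP ey.
by rewrite linearP ex ey scaler0 addr0.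
Qed.
HB.instance Definition _ f := GRing.isSubmodClosed.Build R U (ker f) (ker_submod f).

Definition im (f : {linear U -> V}) : {pred V} :=
  [pred y | `[< exists x, f x = y >]].
Fact im_submod f : submod_closed (im f).
Proof.
split; first by rewrite inE; apply/asboolP; exists 0; rewrite linear0.
move=> a x y; rewrite !inE => /asboolP[x' <-] /asboolP[y' <-].
by apply/asboolP; exists (a *: x' + y'); rewrite linearP.
Qed.
HB.instance Definition _ f := GRing.isSubmodClosed.Build R V (im f) (im_submod f).

Lemma kerP (f : {linear U -> V}) x : reflect (f x = 0) (x \in ker f).
Proof. by rewrite inE; apply: eqP. Qed.

Lemma imP (f : {linear U -> V}) y : reflect (exists x, f x = y) (y \in im f).
Proof. by rewrite inE; apply: asboolP. Qed.

End Submodules.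

Section Subquotient.
Variable V : lmodType R.

Record submodule (Z : submodClosed V) := Submodule {
  submodule_val :> V;
  submodule_mem : submodule_val \in Z }.

HB.instance Definition _ (Z : submodClosed V) :=
  [isSub for @submodule_val Z].
HB.instance Definition _ (Z : submodClosed V) :=
  [Choice of submodule Z by <:].
HB.instance Definition _ (Z : submodClosed V) :=
  [SubChoice_isSubLmodule of submodule Z by <:].

End Subquotient.

Section Quotient.
Variables (V : lmodType R) (I : submodClosed V).

(* [submodClosed] does not inherit from the [zmodClosed] expected by
   [Quotient.quot]. *)
Definition quot_pred : {pred V} := [pred x | x \in I].
Fact quot_pred_submod : submod_closed quot_pred.
Proof. exact: submodClosedP. Qed.
HB.instance Definition _ :=
  GRing.isSubmodClosed.Build R V quot_pred quot_pred_submod.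

Definition lquot := Quotient.quot quot_pred.
HB.instance Definition _ := GRing.Zmodule.on lquot.

Definition lquot_class (x : V) : lquot := \pi_(Quotient.quot quot_pred)%qT x.
Definition lquot_repr (x : lquot) : V := generic_quotient.repr x.

Lemma lquot_reprK : cancel lquot_repr lquot_class.
Proof. exact: generic_quotient.reprK. Qed.

Lemma lquot_classP x y : reflect (lquot_class x = lquot_class y) (x - y \in I).
Proof.
have -> : (x - y \in I) = (x - y \in quot_pred) by [].
by rewrite Quotient.idealrBE; apply: eqP.
Qed.

Lemma lquot_classD x y : lquot_class (x + y) = lquot_class x + lquot_class y.
Proof. exact: (Quotient.pi_add quot_pred). Qed.

Definition lquot_scale a (x : lquot) : lquot := lquot_class (a *: lquot_repr x).

Lemma lquot_classZ a x : lquot_class (a *: x) = lquot_scale a (lquot_class x).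
Proof.
apply/lquot_classP; rewrite -scalerBr rpredZ //.
by apply/lquot_classP; rewrite lquot_reprK.
Qed.

Fact lquot_scaleA a b x :
  lquot_scale a (lquot_scale b x) = lquot_scale (a * b) x.
Proof. by rewrite -[x]lquot_reprK -!lquot_classZ scalerA. Qed.
Fact lquot_scale1 : left_id 1 lquot_scale.
Proof. by move=> x; rewrite -[x]lquot_reprK -!lquot_classZ scale1r. Qed.
Fact lquot_scaleDr : right_distributive lquot_scale +%R.
Proof.
move=> a x y; rewrite -[x]lquot_reprK -[y]lquot_reprK -lquot_classD.
by rewrite -!lquot_classZ scalerDr lquot_classD.
Qed.
Fact lquot_scaleDl v : {morph lquot_scale^~ v : a b / a + b}.
Proof.
by move=> a b; rewrite -[v]lquot_reprK -!lquot_classZ scalerDl lquot_classD.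
Qed.
HB.instance Definition _ :=
  GRing.Zmodule_isLmodule.Build R lquot
    lquot_scaleA lquot_scale1 lquot_scaleDr lquot_scaleDl.

Fact lquot_class_linear : linear lquot_class.
Proof. by move=> a x y; rewrite lquot_classD lquot_classZ. Qed.
HB.instance Definition _ :=
  GRing.isLinear.Build R V lquot *:%R lquot_class lquot_class_linear.

End Quotient.

Section SubquotientMaps.
Variables (V : lmodType R) (Z B : submodClosed V).

Definition sub_in : {pred submodule Z} := [pred x | val x \in B].
Fact sub_in_submod : submod_closed sub_in.
Proof.
split; first by rewrite inE rpred0.
by move=> a x y; rewrite !inE => hx hy; rewrite /= rpredD // rpredZ.
Qed.
HB.instance Definition _ :=
  GRing.isSubmodClosed.Build R (submodule Z) sub_in sub_in_submod.

(* Z / (Z :&: B); in all uses below B is contained in Z. *)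
Definition subquot : lmodType R := lquot sub_in.

Definition subquot_class (x : V) (xZ : x \in Z) : subquot :=
  lquot_class sub_in (Submodule xZ).

End SubquotientMaps.

Section SubquotientFunct.
Variables (V W : lmodType R) (Z B : submodClosed V) (Z' B' : submodClosed W).
Variable f : {linear V -> W}.
Hypothesis fZ : forall x, x \in Z -> f x \in Z'.

Definition subquot_map (_ : forall x, x \in B -> f x \in B')
  (x : subquot Z B) : subquot Z' B' :=
  subquot_class B' (fZ (submodule_mem (lquot_repr x))).

Hypothesis fB : forall x, x \in B -> f x \in B'.

Lemma subquot_mapE x (xZ : x \in Z) :
  subquot_map fB (subquot_class B xZ) = subquot_class B' (fZ xZ).
Proof.
apply/lquot_classP; rewrite inE /= -linearB; apply: fB.
by move/lquot_classP: (lquot_reprK (subquot_class B xZ)); rewrite inE.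
Qed.

Fact subquot_map_linear : linear (subquot_map fB).
Proof.
move=> a x y; rewrite -[x]lquot_reprK -[y]lquot_reprK -linearP.
case: (lquot_repr x) (lquot_repr y) => [u uZ] [v vZ].
have auvZ : a *: u + v \in Z by rewrite rpredD // rpredZ.
have -> : a *: Submodule uZ + Submodule vZ = Submodule auvZ by apply: val_inj.
rewrite -/(subquot_class B auvZ) -/(subquot_class B uZ) -/(subquot_class B vZ).
rewrite !subquot_mapE -linearP; congr lquot_class; apply: val_inj => /=.
by rewrite linearP.
Qed.
HB.instance Definition _ :=
  GRing.isLinear.Build R (subquot Z B) (subquot Z' B') *:%R
    (subquot_map fB) subquot_map_linear.

End SubquotientFunct.
End Modules.

Arguments subquot_map {R V W Z B Z' B'} f fZ _.

Record rmod (R : comPzRingType) (E : category) := RMod {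
  mobj :> E -> lmodType R;
  mmap : forall a b, Hom a b -> {linear mobj a -> mobj b};
  mmap_id : forall a x, mmap (idc a) x = x;
  mmap_comp : forall a b c (g : Hom b c) (f : Hom a b) x,
    mmap (comp g f) x = mmap g (mmap f x) }.

Arguments mmap {R E} _ {a b}.

Definition const_rmod (R : comPzRingType) (E : category) : rmod R E :=
  @RMod R E (fun=> R^o) (fun _ _ _ => idfun) (fun _ _ => erefl)
    (fun _ _ _ _ _ _ => erefl).

Definition pull_rmod (R : comPzRingType) (A B : category) (psi : functor A B)
  (M : rmod R B) : rmod R A.
Proof.
refine (@RMod R A (fun a => M (psi a)) (fun a b f => mmap M (fmap psi f)) _ _).
- by move=> a x; rewrite fmap_id mmap_id.
- by move=> a b c g f x; rewrite fmap_comp mmap_comp.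
Defined.

Section RModHom.
Variables (R : comPzRingType) (E : category).

Section Def.
Variables A B : rmod R E.

Record rmod_hom := RModHom {
  rhom :> forall e, A e -> B e;
  rhom_linear : forall e, linear (@rhom e);
  rhom_nat : forall a b (f : Hom a b) x,
    @rhom b (mmap A f x) = mmap B f (@rhom a x) }.

HB.instance Definition _ (h : rmod_hom) e :=
  GRing.isLinear.Build R (A e) (B e) *:%R (@rhom h e) (@rhom_linear h e).

Lemma rmod_homP (g h : rmod_hom) : (forall e x, g e x = h e x) -> g = h.
Proof.
case: g h => [g gl gn] [h hl hn] /= e; have egh : g = h.
  apply: functional_extensionality_dep => c.
  by apply: functional_extensionality_dep => x; apply: e.
by subst h; congr RModHom; apply: Prop_irrelevance.
Qed.

HB.instance Definition _ := gen_eqMixin rmod_hom.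
HB.instance Definition _ := gen_choiceMixin rmod_hom.

Definition rhom0 : rmod_hom.
Proof.
exists (fun e _ => 0) => [e a x y|a b f x]; first by rewrite scaler0 addr0.
by rewrite linear0.
Defined.

Definition rhomN (h : rmod_hom) : rmod_hom.
Proof.
exists (fun e x => - h e x) => [e a x y|a b f x].
  by rewrite linearP opprD scalerN.
by rewrite rhom_nat linearN.
Defined.

Definition rhomD (g h : rmod_hom) : rmod_hom.
Proof.
exists (fun e x => g e x + h e x) => [e a x y|a b f x].
  by rewrite !linearP scalerDr addrACA.
by rewrite !rhom_nat linearD.
Defined.

Definition rhomZ (k : R) (h : rmod_hom) : rmod_hom.
Proof.
exists (fun e x => k *: h e x) => [e a x y|a b f x].
  by rewrite linearP scalerDr !scalerA mulrC.
by rewrite rhom_nat linearZ.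
Defined.

Fact rhomDA : associative rhomD.
Proof. by move=> x y z; apply: rmod_homP => e u; apply: addrA. Qed.
Fact rhomDC : commutative rhomD.
Proof. by move=> x y; apply: rmod_homP => e u; apply: addrC. Qed.
Fact rhom0D : left_id rhom0 rhomD.
Proof. by move=> x; apply: rmod_homP => e u; apply: add0r. Qed.
Fact rhomND : left_inverse rhom0 rhomN rhomD.
Proof. by move=> x; apply: rmod_homP => e u; apply: addNr. Qed.
HB.instance Definition _ :=
  GRing.isZmodule.Build rmod_hom rhomDA rhomDC rhom0D rhomND.

Fact rhomZA a b x : rhomZ a (rhomZ b x) = rhomZ (a * b) x.
Proof. by apply: rmod_homP => e u; apply: scalerA. Qed.
Fact rhom1Z : left_id 1 rhomZ.
Proof. by move=> x; apply: rmod_homP => e u; apply: scale1r. Qed.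
Fact rhomZDr : right_distributive rhomZ +%R.
Proof. by move=> a x y; apply: rmod_homP => e u; apply: scalerDr. Qed.
Fact rhomZDl v : {morph rhomZ^~ v : a b / a + b}.
Proof. by move=> a b; apply: rmod_homP => e u; apply: scalerDl. Qed.
HB.instance Definition _ :=
  GRing.Zmodule_isLmodule.Build R rmod_hom rhomZA rhom1Z rhomZDr rhomZDl.

End Def.

Definition rhom_comp (A B C : rmod R E) (g : rmod_hom B C) (f : rmod_hom A B) :
  rmod_hom A C.
Proof.
exists (fun e x => g e (f e x)) => [e a x y|a b h x]; first by rewrite !linearP.
by rewrite !rhom_nat.
Defined.

Definition rhom_pre (A B C : rmod R E) (f : rmod_hom A B) (g : rmod_hom B C) :
  rmod_hom A C := rhom_comp g f.

Fact rhom_pre_linear (A B C : rmod R E) (f : rmod_hom A B) :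
  linear (@rhom_pre A B C f).
Proof. by move=> a g h; apply: rmod_homP. Qed.
HB.instance Definition _ (A B C : rmod R E) (f : rmod_hom A B) :=
  GRing.isLinear.Build R (rmod_hom B C) (rmod_hom A C) *:%R
    (@rhom_pre A B C f) (@rhom_pre_linear A B C f).

(* Epimorphisms of RE-modules are the objectwise surjections. *)
Definition rmod_surj (A B : rmod R E) (f : rmod_hom A B) : Prop :=
  forall e y, exists x, f e x = y.

Definition projective (P : rmod R E) : Prop :=
  forall (A B : rmod R E) (p : rmod_hom A B) (g : rmod_hom P B),
    rmod_surj p -> exists h : rmod_hom P A, rhom_comp p h = g.

Record proj_resolution (F : rmod R E) := ProjResolution {
  res :> nat -> rmod R E;
  res_d : forall n, rmod_hom (res n.+1) (res n);
  res_aug : rmod_hom (res 0%N) F;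
  res_proj : forall n, projective (res n);
  res_aug_surj : rmod_surj res_aug;
  res_exact0 : forall e x, res_aug e x = 0 <-> exists y, res_d 0%N e y = x;
  res_exactS : forall n e x,
    res_d n e x = 0 <-> exists y, res_d n.+1 e y = x }.

End RModHom.

Record cochain (R : comPzRingType) := Cochain {
  cob :> nat -> lmodType R;
  cd : forall n, {linear cob n -> cob n.+1};
  cdd : forall n x, cd n.+1 (cd n x) = 0 }.

Arguments cd {R} _ {n}.

Section Cohomology.
Variable R : comPzRingType.

Definition cocycles (X : cochain R) (n : nat) : submodClosed (X n) :=
  ker (@cd R X n).

Definition coboundaries (X : cochain R) (n : nat) : submodClosed (X n) :=
  match n with
  | 0 => @zero_sub R (X 0%N)
  | m.+1 => im (@cd R X m)
  end.

Definition cohomology (X : cochain R) (n : nat) : lmodType R :=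
  subquot (cocycles X n) (coboundaries X n).

Record cochain_map (X Y : cochain R) := CochainMap {
  cmap :> forall n, {linear X n -> Y n};
  cmapd : forall n x, cmap n.+1 (cd X x) = cd Y (cmap n x) }.

Section Map.
Variables (X Y : cochain R) (f : cochain_map X Y) (n : nat).

Lemma cmap_cocycles x : x \in cocycles X n -> f n x \in cocycles Y n.
Proof. by move=> /kerP dx; apply/kerP; rewrite -cmapd dx linear0. Qed.

Lemma cmap_coboundaries x : x \in coboundaries X n -> f n x \in coboundaries Y n.
Proof.
case: n x => [|m] x; first by rewrite !inE => /eqP ->; rewrite linear0.
by move=> /imP[y <-]; apply/imP; exists (f m y); rewrite cmapd.
Qed.

Definition cohomology_map : {linear cohomology X n -> cohomology Y n} :=
  subquot_map (f n) cmap_cocycles cmap_coboundaries.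

Lemma cohomology_mapE x (xZ : x \in cocycles X n) :
  cohomology_map (subquot_class (coboundaries X n) xZ) =
  subquot_class (coboundaries Y n) (cmap_cocycles xZ).
Proof. exact: subquot_mapE. Qed.

End Map.

Lemma subquot_class_surj (V : lmodType R) (Z B : submodClosed V)
  (x : subquot Z B) : exists y (yZ : y \in Z), x = subquot_class B yZ.
Proof.
rewrite -[x]lquot_reprK; case: (lquot_repr x) => y yZ.
by exists y, yZ.
Qed.

Lemma subquot_class_eq (V : lmodType R) (Z B : submodClosed V) x y
    (xZ : x \in Z) (yZ : y \in Z) :
  x = y -> subquot_class B xZ = subquot_class B yZ.
Proof. by move=> e; subst y; congr subquot_class; apply: bool_irrelevance. Qed.

End Cohomology.

Section Ext.
Variables (R : comPzRingType) (E : category).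

Definition hom_cochain (F : rmod R E) (P : proj_resolution F) (A : rmod R E) :
  cochain R.
Proof.
refine (@Cochain R (fun n => rmod_hom (P n) A)
          (fun n => rhom_pre (res_d P n)) _).
move=> n g; apply: rmod_homP => e x /=.
have /res_exactS -> : exists y, res_d P n.+1 e y = res_d P n.+1 e x by exists x.
by rewrite linear0.
Defined.

End Ext.

Section Cosimplicial.
Variables (R : comPzRingType) (A : rmod R Delta).

Definition cosimp_d (n : nat) (x : A n) : A n.+1 :=
  \sum_(i < n.+2) (-1) ^+ i *: mmap A (coface i) x.

Fact cosimp_d_linear n : linear (@cosimp_d n).
Proof.
move=> a x y; rewrite /cosimp_d scaler_sumr -big_split /=; apply: eq_bigr => i _.
by rewrite linearP scalerDr !scalerA mulrC.
Qed.
HB.instance Definition _ n :=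
  GRing.isLinear.Build R (A n) (A n.+1) *:%R (@cosimp_d n) (@cosimp_d_linear n).

Lemma coface_comp n (i : 'I_n.+2) (j : 'I_n.+2) : (i <= j)%N ->
  comp (coface (lift ord0 j)) (coface i) =
  comp (coface (widen_ord (leqnSn _) i)) (coface j).
Proof.
move=> ij; apply: eq_exist; apply/funext => k; apply: val_inj => /=.
rewrite /bump /=; case: leqP; case: leqP; case: leqP; case: leqP; lia.
Qed.

Lemma cosimp_dd n (x : A n) : cosimp_d (cosimp_d x) = 0.
Proof.
pose t (j : 'I_n.+3) (i : 'I_n.+2) : A n.+2 :=
  (-1) ^+ (j + i) *: mmap A (comp (coface j) (coface i)) x.
have -> : cosimp_d (cosimp_d x) = \sum_j \sum_i t j i.
  apply: eq_bigr => j _; rewrite linear_sum scaler_sumr; apply: eq_bigr => i _.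
  by rewrite /t linearZ scalerA -exprD mmap_comp.
rewrite pair_big /= (bigID (fun p : 'I_n.+3 * 'I_n.+2 => p.2 < p.1)%N) /=.
apply/eqP; rewrite addr_eq0 -sumrN; apply/eqP.
pose h (p : 'I_n.+3 * 'I_n.+2) : 'I_n.+3 * 'I_n.+2 :=
  (widen_ord (leqnSn _) p.2, inord p.1.-1).
pose h' (p : 'I_n.+3 * 'I_n.+2) : 'I_n.+3 * 'I_n.+2 :=
  (lift ord0 p.2, inord p.1).
rewrite (reindex_onto h' h) /=; last first.
  move=> [j i] /= ij; rewrite /h' /h /=; congr pair; apply: val_inj => /=.
    rewrite /bump inordK; last by have := ltn_ord j; lia.
    by have := ltn_ord j; lia.
  by rewrite inordK.
apply: eq_big => [[j i]|[j i] /andP[ij /eqP[ej _]]] /=.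
  rewrite -leqNgt; apply/andP/idP => [[ij /eqP[/(congr1 val) /= ej _]]|ji].
    by move: ij; rewrite /bump; lia.
  have ltj : (j < n.+2)%N by exact: leq_ltn_trans ji (ltn_ord i).
  rewrite inordK // /bump; split; first by lia.
  apply/eqP; congr pair; apply: val_inj => /=; rewrite inordK //.
  by rewrite add0n.
rewrite /t coface_comp; last by move: ij; rewrite /= /bump; lia.
rewrite ej; have /= -> := congr1 val ej.
by rewrite /bump add1n addSn exprS mulN1r scaleNr addnC.
Qed.

Definition cosimp_cochain : cochain R :=
  @Cochain R A (fun n => @cosimp_d n) cosimp_dd.

End Cosimplicial.

Section CosimplicialMap.
Variables (R : comPzRingType) (A B : rmod R Delta) (h : rmod_hom A B).

Definition cosimp_map : cochain_map (cosimp_cochain A) (cosimp_cochain B).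
Proof.
refine (@CochainMap R (cosimp_cochain A) (cosimp_cochain B) (fun n => h n) _).
move=> n x /=; rewrite /cosimp_d linear_sum; apply: eq_bigr => i _.
by rewrite linearZ /= rhom_nat.
Defined.

End CosimplicialMap.

Section GabrielZisman.
Variable R : comPzRingType.

Notation coef_system X := (rmod R (simplices X)).

Section Complex.
Variables (X : sset) (M : coef_system X).

Definition gz_ob (n : nat) : lmodType R := dprod (fun s : X n => M (simplex s)).

Definition gz_act m n (f : @Hom Delta m n) (z : gz_ob m) : gz_ob n :=
  fun s => mmap M (simplices_lift f s) (z (smap X f s)).

Fact gz_act_linear m n (f : @Hom Delta m n) : linear (gz_act f).
Proof. by move=> a x y; apply: dprodP => s; rewrite /gz_act linearP. Qed.
HB.instance Definition _ m n (f : @Hom Delta m n) :=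
  GRing.isLinear.Build R (gz_ob m) (gz_ob n) *:%R (gz_act f) (gz_act_linear f).

(* The morphism of Delta(X) carried by f does not depend on the proof of
   f^*s = t. *)
Lemma gz_transport m n (f : @Hom Delta m n) (s : X n) (t : X m)
    (e : smap X f s = t) (z : gz_ob m) :
  mmap M (exist _ f e : Hom (simplex t) (simplex s)) (z t) = gz_act f z s.
Proof. by subst t. Qed.

Definition gz_cosimp : rmod R Delta.
Proof.
refine (@RMod R Delta gz_ob gz_act _ _).
- move=> n z; apply: dprodP => s.
  rewrite -[LHS](gz_transport (smap_id s) z).
  by rewrite -[RHS](mmap_id (r := M) (z s)); congr (mmap M _ _); apply: eq_exist.
- move=> m n p g f z; apply: dprodP => s.
  rewrite -[LHS](gz_transport (smap_comp g f s) z) /= /gz_act -mmap_comp.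
  by congr (mmap M _ _); apply: eq_exist.
Defined.

Definition gz_cochain : cochain R := cosimp_cochain gz_cosimp.

Definition gz_cohomology (n : nat) : lmodType R := cohomology gz_cochain n.

End Complex.

Section Pullback.
Variables (X Y : sset) (h : sset_map X Y) (M : coef_system Y).

Definition gz_pull_fun n (z : gz_cosimp M n) :
  gz_cosimp (pull_rmod (simplices_map h) M) n := fun s => z (h _ s).

Definition gz_pull :
  rmod_hom (gz_cosimp M) (gz_cosimp (pull_rmod (simplices_map h) M)).
Proof.
exists gz_pull_fun => [n a x y //|m n f z]; apply: dprodP => s.
rewrite /= /gz_pull_fun -(gz_transport (esym (smorP h f s))).
by rewrite /= /gz_act /=; congr (mmap M _ _); apply: eq_exist.
Defined.

End Pullback.

Section Coefficients.
Variables (X : sset) (M L : coef_system X) (u : rmod_hom M L).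

Definition gz_coef_fun n (z : gz_cosimp M n) : gz_cosimp L n :=
  fun s => u (simplex s) (z s).

Definition gz_coef : rmod_hom (gz_cosimp M) (gz_cosimp L).
Proof.
exists gz_coef_fun => [n a x y|m n f z]; apply: dprodP => s.
  by rewrite /gz_coef_fun linearP.
by rewrite /gz_coef_fun /= /gz_act rhom_nat.
Defined.

End Coefficients.
End GabrielZisman.

Notation coef_system R X := (rmod R (simplices X)).

Section Thomason.
Variable R : comPzRingType.

Definition Hth (C : category) (M : coef_system R (nerve C)) (n : nat) :
  lmodType R := gz_cohomology M n.

Definition pull_coef (A B : category) (psi : functor A B)
  (M : coef_system R (nerve B)) : coef_system R (nerve A) :=
  pull_rmod (simplices_map (nerve_map psi)) M.

Definition Hth_pull (A B : category) (psi : functor A B)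
    (M : coef_system R (nerve B)) (n : nat) :
  {linear Hth M n -> Hth (pull_coef psi M) n} :=
  cohomology_map (cosimp_map (gz_pull (nerve_map psi) M)) n.

Definition Hth_coef (A : category) (M L : coef_system R (nerve A))
    (u : rmod_hom M L) (n : nat) : {linear Hth M n -> Hth L n} :=
  cohomology_map (cosimp_map (gz_coef u)) n.

Variables (C D : category) (phi : functor C D) (M : coef_system R (nerve C)).

Definition comma_coef (d : D) : coef_system R (nerve (comma phi d)) :=
  pull_coef (comma_forget phi d) M.

Section Push.
Variables (d d' : D) (beta : Hom d d').

Lemma nerve_comma_push n (s : nerve (comma phi d) n) :
  nerve_map (comma_forget phi d') n (nerve_map (comma_push phi beta) n s) =
  nerve_map (comma_forget phi d) n s.
Proof. exact: functor_eq. Qed.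

(* The identification (beta_* )^* (j^* M) = j^* M coming from j o beta_* = j.
   The two simplices below are equal, but not convertible (functors carry
   proofs), so M is applied to the identity morphism between them. *)
Definition comma_coef_id :
  rmod_hom (pull_coef (comma_push phi beta) (comma_coef d')) (comma_coef d).
Proof.
exists (fun s x => mmap M (simplices_eq (nerve_comma_push (projT2 s))) x).
  by move=> s a x y; rewrite linearP.
move=> s t f x; rewrite /= -!mmap_comp; congr (mmap M _ _).
by apply: eq_exist; apply: etrans (comp1f _) (esym (compf1 _)).
Defined.

Definition Hth_comma_map n :
  {linear Hth (comma_coef d') n -> Hth (comma_coef d) n} :=
  Hth_coef comma_coef_id n \o Hth_pull (comma_push phi beta) (comma_coef d') n.

Lemma Hth_comma_mapE n z (hz : z \in cocycles (gz_cochain (comma_coef d')) n) :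
  exists hw : gz_coef comma_coef_id n
                (gz_pull (nerve_map (comma_push phi beta)) (comma_coef d') n z)
              \in cocycles (gz_cochain (comma_coef d)) n,
  Hth_comma_map n (subquot_class (coboundaries _ n) hz) =
  subquot_class (coboundaries _ n) hw.
Proof.
pose u := cosimp_map (gz_pull (nerve_map (comma_push phi beta)) (comma_coef d')).
pose v := cosimp_map (gz_coef comma_coef_id).
exists (cmap_cocycles v (cmap_cocycles u hz)).
exact: etrans (congr1 (cohomology_map v n) (cohomology_mapE u hz))
              (cohomology_mapE v _).
Qed.

End Push.
End Thomason.

Section ThomasonFunctor.
Variable R : comPzRingType.
Variables (C D : category) (phi : functor C D) (M : coef_system R (nerve C)).

Lemma comma_coef_transport (d : D) n (z : gz_ob (comma_coef phi M d) n)
    (t s : nerve (comma phi d) n) (r : simplices (nerve C))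
    (f : Hom (simplex (nerve_map (comma_forget phi d) n t)) r)
    (g : Hom (simplex (nerve_map (comma_forget phi d) n s)) r) :
  t = s -> sval f = sval g -> mmap M f (z t) = mmap M g (z s).
Proof.
move=> ets; subst t; case: f g => [f ef] [g eg] /= efg.
by congr (mmap M _ _); apply: eq_exist.
Qed.

Definition Hth_comma (n : nat) : rmod R (op D).
Proof.
refine (@RMod R (op D) (fun d : D => Hth (comma_coef phi M d) n)
  (fun d' d beta => Hth_comma_map phi M beta n) _ _).
- move=> d x; have [z [hz ->]] := subquot_class_surj x.
  have [hw ->] := Hth_comma_mapE (@idc D d) hz.
  apply: subquot_class_eq; apply: dprodP => s.
  rewrite -[RHS](mmap_id (r := M) (z s)).
  exact: (@comma_coef_transport d n z _ s _
            (simplices_eq (@nerve_comma_push C D phi d d (idc d) n s)) (idc _)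
            (comma_push_id s) erefl).
- move=> d d' d'' f g x; have [z [hz ->]] := subquot_class_surj x.
  have [hw ->] := Hth_comma_mapE (@comp D d'' d' d g f) hz.
  have [hw1 ->] := Hth_comma_mapE (D := D) g hz.
  have [hw2 ->] := Hth_comma_mapE (D := D) f hw1.
  apply: subquot_class_eq; apply: dprodP => s.
  rewrite [RHS]/= /gz_coef_fun /= /gz_pull_fun /= /gz_coef_fun /= -mmap_comp.
  pose e := @nerve_comma_push C D phi d'' d (@comp D d'' d' d g f) n s.
  pose ef := @nerve_comma_push C D phi d'' d' f n s.
  pose eg := @nerve_comma_push C D phi d' d g n (fcomp (comma_push phi f) s).
  pose ets := @comma_push_comp C D phi (ordcat n) d'' d' d g f s.
  exact: (@comma_coef_transport d n z _ _ _ (simplices_eq e)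
            (comp (simplices_eq ef) (simplices_eq eg)) ets (esym (comp1f _))).
Defined.

End ThomasonFunctor.

Section FreeModule.
Variables (R : comPzRingType) (X : Type).

(* The free R-module on X, as formal linear combinations modulo equality of
   their values under every map from X to an R-module. *)
Inductive fterm :=
  | FZero
  | FVar of X
  | FAdd of fterm & fterm
  | FScale of R & fterm.

HB.instance Definition _ := gen_eqMixin fterm.
HB.instance Definition _ := gen_choiceMixin fterm.

Fixpoint feval (V : lmodType R) (v : X -> V) (t : fterm) : V :=
  match t with
  | FZero => 0
  | FVar x => v x
  | FAdd s t => feval v s + feval v t
  | FScale a t => a *: feval v t
  end.

Definition fequiv (s t : fterm) : bool :=
  `[< forall (V : lmodType R) (v : X -> V), feval v s = feval v t >].

Fact fequiv_is_equiv : equiv_class_of fequiv.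
Proof.
split=> [t|s t|t s u]; first exact/asboolP.
  by apply/asboolP/asboolP => h V v; rewrite h.
by move=> /asboolP h1 /asboolP h2; apply/asboolP => V v; rewrite h1.
Qed.

Canonical fequiv_equiv := EquivRelPack fequiv_is_equiv.
Canonical fequiv_encModRel := defaultEncModRel fequiv.

Definition freemod := {eq_quot fequiv}%qT.
HB.instance Definition _ := Choice.on freemod.

Definition fclass (t : fterm) : freemod := \pi_({eq_quot fequiv})%qT t.
Definition frepr (x : freemod) : fterm := generic_quotient.repr x.

Lemma freprK : cancel frepr fclass.
Proof. exact: reprK. Qed.

Definition fext (V : lmodType R) (v : X -> V) (x : freemod) : V :=
  feval v (frepr x).

Lemma fextE (V : lmodType R) (v : X -> V) t : fext v (fclass t) = feval v t.
Proof.
have /eqmodP/asboolP h : fclass (frepr (fclass t)) = fclass t := freprK _.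
exact: h.
Qed.

Lemma freemodP (x y : freemod) :
  (forall (V : lmodType R) (v : X -> V), fext v x = fext v y) -> x = y.
Proof.
move=> h; rewrite -[x]freprK -[y]freprK; apply/eqmodP/asboolP => V v.
by have := h V v.
Qed.

Definition fzero : freemod := fclass FZero.
Definition fvar (x : X) : freemod := fclass (FVar x).
Definition fadd (x y : freemod) : freemod := fclass (FAdd (frepr x) (frepr y)).
Definition fscale a (x : freemod) : freemod := fclass (FScale a (frepr x)).
Definition fopp (x : freemod) : freemod := fscale (-1) x.

Lemma fext0 (V : lmodType R) (v : X -> V) : fext v fzero = 0.
Proof. by rewrite fextE. Qed.
Lemma fextD (V : lmodType R) (v : X -> V) x y :
  fext v (fadd x y) = fext v x + fext v y.
Proof. by rewrite fextE. Qed.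
Lemma fextZ (V : lmodType R) (v : X -> V) a x :
  fext v (fscale a x) = a *: fext v x.
Proof. by rewrite fextE. Qed.

Let fextLE := (fext0, fextD, fextZ).

Fact faddA : associative fadd.
Proof. by move=> x y z; apply: freemodP => V v; rewrite !fextLE addrA. Qed.
Fact faddC : commutative fadd.
Proof. by move=> x y; apply: freemodP => V v; rewrite !fextLE addrC. Qed.
Fact fadd0 : left_id fzero fadd.
Proof. by move=> x; apply: freemodP => V v; rewrite !fextLE add0r. Qed.
Fact faddN : left_inverse fzero fopp fadd.
Proof.
by move=> x; apply: freemodP => V v; rewrite !fextLE scaleN1r addNr.
Qed.
HB.instance Definition _ := GRing.isZmodule.Build freemod faddA faddC fadd0 faddN.

Fact fscaleA a b x : fscale a (fscale b x) = fscale (a * b) x.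
Proof. by apply: freemodP => V v; rewrite !fextLE scalerA. Qed.
Fact fscale1 : left_id 1 fscale.
Proof. by move=> x; apply: freemodP => V v; rewrite !fextLE scale1r. Qed.
Fact fscaleDr : right_distributive fscale +%R.
Proof.
by move=> a x y; apply: freemodP => V v; rewrite !fextLE scalerDr.
Qed.
Fact fscaleDl u : {morph fscale^~ u : a b / a + b}.
Proof.
by move=> a b; apply: freemodP => V v; rewrite !fextLE scalerDl.
Qed.
HB.instance Definition _ :=
  GRing.Zmodule_isLmodule.Build R freemod fscaleA fscale1 fscaleDr fscaleDl.

Fact fext_linear (V : lmodType R) (v : X -> V) : linear (fext v).
Proof. by move=> a x y; rewrite fextD fextZ. Qed.
HB.instance Definition _ (V : lmodType R) (v : X -> V) :=
  GRing.isLinear.Build R freemod V *:%R (fext v) (fext_linear v).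

Lemma fext_var (V : lmodType R) (v : X -> V) x : fext v (fvar x) = v x.
Proof. by rewrite fextE. Qed.

Lemma freemod_ext (V : lmodType R) (f g : freemod -> V) :
  linear f -> linear g -> (forall x, f (fvar x) = g (fvar x)) -> f =1 g.
Proof.
move=> fl gl fg x.
pose F : {linear freemod -> V} := HB.pack f (GRing.isLinear.Build _ _ _ _ f fl).
pose G : {linear freemod -> V} := HB.pack g (GRing.isLinear.Build _ _ _ _ g gl).
suff h t : F (fclass t) = G (fclass t) by have := h (frepr x); rewrite freprK.
elim: t => [|y|s IHs t IHt|a t IHt].
- by rewrite -[fclass _]/(0 : freemod) !linear0.
- exact: fg.
- have -> : fclass (FAdd s t) = fclass s + fclass t.
    by apply: freemodP => V' v; rewrite fextD !fextE.
  by rewrite !linearD IHs IHt.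
- have -> : fclass (FScale a t) = a *: fclass t.
    by apply: freemodP => V' v; rewrite fextZ !fextE.
  by rewrite !linearZ IHt.
Qed.

End FreeModule.

Section FreeCover.
Variables (R : comPzRingType) (E : category) (F : rmod R E).

(* The direct sum, over all a in E and u in F a, of the representable
   RE-modules R[Hom(a, -)]. *)
Definition cover_gen (e : E) := {a : E & (F a * Hom a e)%type}.

Definition cover_push (e e' : E) (f : Hom e e') (g : cover_gen e) : cover_gen e' :=
  existT _ (projT1 g) ((projT2 g).1, comp f (projT2 g).2).

Definition cover_act (e e' : E) (f : Hom e e') :
  {linear freemod R (cover_gen e) -> freemod R (cover_gen e')} :=
  fext (fun g => fvar R (cover_push f g)).

Definition free_cover : rmod R E.
Proof.
refine (@RMod R E (fun e => freemod R (cover_gen e)) cover_act _ _).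
- move=> e; apply: freemod_ext => [|//|x]; first exact: linearP.
  rewrite /= fext_var; congr fvar.
  by case: x => a [u f]; rewrite /cover_push /= comp1f.
- move=> a b c g f; apply: freemod_ext => [||x].
  + exact: linearP.
  + by move=> k x y; rewrite !linearP.
  rewrite /= !fext_var; congr fvar.
  by case: x => a' [u h]; rewrite /cover_push /= compA.
Defined.

Definition cover_map : rmod_hom free_cover F.
Proof.
exists (fun e => fext (fun g : cover_gen e => mmap F (projT2 g).2 (projT2 g).1)).
  by move=> e; apply: fext_linear.
move=> a b f; apply: freemod_ext => [||[e [u h]]].
- by move=> k x y; rewrite !linearP.
- by move=> k x y; rewrite !linearP.
by rewrite /= !fext_var /= mmap_comp.
Defined.

Lemma cover_map_surj : rmod_surj cover_map.
Proof.
move=> e y; exists (fvar R (existT _ e (y, idc e))).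
by rewrite /= fext_var mmap_id.
Qed.

Lemma free_cover_proj : projective free_cover.
Proof.
move=> A B p g p_surj.
pose gen a (u : F a) : free_cover a := fvar R (existT _ a (u, idc a)).
pose l a u := cid (p_surj a (g a (gen a u))).
pose h e := fext (fun s : cover_gen e =>
  mmap A (projT2 s).2 (sval (l _ (projT2 s).1))).
have h_nat a b (f : Hom a b) x : h b (mmap free_cover f x) = mmap A f (h a x).
  move: x; apply: freemod_ext => [||[e [u k]]].
  - by move=> k x y; rewrite /h !linearP.
  - by move=> k x y; rewrite /h !linearP.
  by rewrite /h /= !fext_var /= mmap_comp.
have h_lin e : linear (h e) by exact: fext_linear.
exists (@RModHom R E free_cover A h h_lin h_nat).
apply: rmod_homP => e; apply: freemod_ext => [||[a [u k]]].
- by move=> k x y; rewrite /h !linearP.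
- by move=> k x y; rewrite /h !linearP.
rewrite /= /h fext_var /= rhom_nat (svalP (l a u)) -rhom_nat /gen /= fext_var.
by rewrite /cover_push /= compf1.
Qed.

End FreeCover.

Section Kernel.
Variables (R : comPzRingType) (E : category) (A B : rmod R E) (f : rmod_hom A B).

Definition rker_ob (e : E) : submodClosed (A e) := ker (f e).

Fact rker_act_subproof a b (h : Hom a b) x :
  x \in rker_ob a -> mmap A h x \in rker_ob b.
Proof. by move=> /kerP fx; apply/kerP; rewrite /= rhom_nat fx linear0. Qed.

Definition rker_act a b (h : Hom a b) (x : submodule (rker_ob a)) :
  submodule (rker_ob b) := Submodule (rker_act_subproof h (submodule_mem x)).

Fact rker_act_linear a b (h : Hom a b) : linear (rker_act h).
Proof. by move=> k x y; apply: val_inj; rewrite /= linearP. Qed.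
HB.instance Definition _ a b (h : Hom a b) :=
  GRing.isLinear.Build R (submodule (rker_ob a)) (submodule (rker_ob b)) *:%R
    (rker_act h) (rker_act_linear h).

Definition rker : rmod R E.
Proof.
refine (@RMod R E (fun e => submodule (rker_ob e)) rker_act _ _).
- by move=> e x; apply: val_inj; rewrite /= mmap_id.
- by move=> a b c g h x; apply: val_inj; rewrite /= mmap_comp.
Defined.

Definition rker_incl : rmod_hom rker A.
Proof. by exists (fun e (x : submodule (rker_ob e)) => val x). Defined.

Lemma rker_inclP e x : f e x = 0 <-> exists y, rker_incl e y = x.
Proof.
split=> [/kerP fx|[[y fy] /= <-]]; first by exists (Submodule fx).
exact/kerP.
Qed.

Lemma rker_incl0 e x : rker_incl e x = 0 <-> x = 0.
Proof. by split=> [x0|->]; [apply: val_inj | ]. Qed.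

End Kernel.

Section FreeResolution.
Variables (R : comPzRingType) (E : category) (F : rmod R E).

Fixpoint syzygy (n : nat) : rmod R E :=
  if n is m.+1 then rker (cover_map (syzygy m)) else F.

Definition free_res_d n :
  rmod_hom (free_cover (syzygy n.+1)) (free_cover (syzygy n)) :=
  rhom_comp (rker_incl (cover_map (syzygy n))) (cover_map (syzygy n.+1)).

Lemma free_res_im n e x :
  cover_map (syzygy n) e x = 0 <-> exists y, free_res_d n e y = x.
Proof.
rewrite rker_inclP; split=> -[y <-]; last by eexists.
by have [z <-] := cover_map_surj (F := syzygy n.+1) y; exists z.
Qed.

Definition free_resolution : proj_resolution F.
Proof.
apply: (@ProjResolution R E F (fun n => free_cover (syzygy n)) free_res_d
          (cover_map F)).
- by move=> n; apply: free_cover_proj.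
- exact: cover_map_surj.
- by move=> e x; have := @free_res_im 0%N e x.
- by move=> n e x; rewrite -free_res_im rker_incl0.
Defined.

End FreeResolution.

(* Ext is computed from the free resolution above; by the comparison theorem
   any other projective resolution gives the same result up to isomorphism. *)
Definition Ext (R : comPzRingType) (E : category) (p : nat) (F A : rmod R E) :
  lmodType R := cohomology (hom_cochain (free_resolution F) A) p.

Definition cat_cohomology (R : comPzRingType) (E : category) (p : nat)
  (A : rmod R E) : lmodType R := Ext p (const_rmod R E) A.

(* Cohomological spectral sequences starting at the second page: the pages
   E_r for r < 2 are irrelevant.  In [ss_iso] the position (p + r, q - r + 1)
   runs over all bidegrees; the differential into it is the one from (p, q).
   Homology is taken as in [subquot]. *)
Record spectral_sequence (R : comPzRingType) := SpectralSequence {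
  page :> nat -> int -> int -> lmodType R;
  ss_d : forall r p q, {linear page r p q -> page r (p + r%:Z) (q - r%:Z + 1)};
  ss_dd : forall r p q x, (2 <= r)%N ->
    ss_d r (p + r%:Z) (q - r%:Z + 1) (ss_d r p q x) = 0;
  ss_iso : forall r p q, (2 <= r)%N ->
    lin_iso (subquot (ker (ss_d r (p + r%:Z) (q - r%:Z + 1))) (im (ss_d r p q)))
            (page r.+1 (p + r%:Z) (q - r%:Z + 1)) }.

Definition first_quadrant (R : comPzRingType) (S : spectral_sequence R) : Prop :=
  forall r p q, (2 <= r)%N -> (p < 0) || (q < 0) -> forall x : S r p q, x = 0.

(* In a first-quadrant spectral sequence no nonzero differential enters or
   leaves the position (p, q) from the page r on as soon as p < r and
   q + 1 < r, so that S r p q is then the limit term at (p, q). *)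
Definition converges (R : comPzRingType) (S : spectral_sequence R)
    (H : nat -> lmodType R) : Prop :=
  exists F : forall n, nat -> submodClosed (H n),
    [/\ forall n x, x \in F n 0%N,
        forall n p x, x \in F n p.+1 -> x \in F n p,
        forall n x, x \in F n n.+1 -> x = 0 &
        forall p q r : nat, (p < r)%N -> (q.+1 < r)%N ->
          inhabited (lin_iso (subquot (F (p + q)%N p) (F (p + q)%N p.+1))
                             (S r p q))].

(* Main.v *)
(* Let P be a projective resolution of the constant module over D^op, and let
   C^q be the D^op-module d |-> C^q(N(phi/d); j^*M).  The spectral sequence is
   the one of the double complex Hom(P_p, C^q), filtered by p.  Since P_p is
   projective, Hom(P_p, -) commutes with the cohomology in the direction q, so
   that E_2 is the cohomology of Hom(P, H^q_Th(phi/-; j^*M)).  In the other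
   direction, a q-simplex of phi/d is a q-simplex s of C together with a
   morphism phi(s_q) -> d, so that C^q is a product of coinduced modules and
   Hom(P_p, C^q) = prod_s Hom_R(P_p(phi(s_q)), M(s)).  The complex of free
   R-modules P(phi(s_q)) -> R splits, hence the rows are exact resolutions of
   C^q(NC; M) and the total cohomology is H_Th(C; M). *)
Require Import Defs.
From HB Require Import structures.
From mathcomp Require Import all_boot all_order all_algebra.
From mathcomp Require Import boolp zify.
(* [Defs] again: the MathComp libraries shadow [comp] and [Hom]. *)
Import Defs GRing.Theory.
Local Open Scope ring_scope.

Set Implicit Arguments.
Unset Strict Implicit.
Unset Printing Implicit Defensive.


(** The modules [M] s are arbitrary, so applying Hom_R(-, M(s)) preserves exactness only because the
    complex P(phi(s_q)) -> R contracts over R. The contraction is not natural in the object of D,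
    and it need not be. All vertices of a simplex of phi/d get their structure maps by composition
    from that of the last vertex, so a morphism from P_p to C^q is the same as a family of R-linear
    maps indexed by the simplices s of C, with no compatibility between different s.

    Three kinds of isomorphisms have to be produced: from the homology of a page to the next page,
    from the graded pieces of the limit to a late page, and from page 2 to the Ext groups. Each one
    compares subquotients between which a map exists only after representatives have been chosen.
    They are therefore all given as linear relations between representatives, and the choice is made
    once, in [rel_map]. *)

Section Subquotients.
Variable R : comPzRingType.

(** * Classes in subquotients and isomorphisms induced by linear relations *)

Lemma submod_rpredP (V : lmodType R) (Z : submodClosed V) a x y :
  x \in Z -> y \in Z -> a *: x + y \in Z.
Proof. by move=> xZ yZ; rewrite rpredD // rpredZ. Qed.

Lemma submod_rpredB (V : lmodType R) (Z : submodClosed V) x y :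
  x \in Z -> y \in Z -> x - y \in Z.
Proof. by move=> xZ yZ; rewrite -scaleN1r addrC submod_rpredP. Qed.

Section Class.
Variables (V : lmodType R) (Z B : submodClosed V).

Lemma subquot_classP x y (xZ : x \in Z) (yZ : y \in Z) :
  subquot_class B xZ = subquot_class B yZ <-> x - y \in B.
Proof.
split=> [/lquot_classP|h]; first by rewrite inE.
by apply/lquot_classP; rewrite inE.
Qed.

Lemma subquot_class0P x (xZ : x \in Z) : subquot_class B xZ = 0 <-> x \in B.
Proof.
have -> : 0 = subquot_class B (rpred0 Z).
  rewrite -[LHS](linear0 (@lquot_class _ _ (sub_in (Z:=Z) B))).
  by congr lquot_class; apply: val_inj.
by rewrite subquot_classP subr0.
Qed.

Lemma subquot_classL a x y (xZ : x \in Z) (yZ : y \in Z)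
    (xyZ : a *: x + y \in Z) :
  subquot_class B xyZ = a *: subquot_class B xZ + subquot_class B yZ.
Proof.
rewrite /subquot_class -linearP; congr lquot_class; exact: val_inj.
Qed.

End Class.

(* A linear relation between two modules, single-valued up to [B] and [B'],
   induces an isomorphism of subquotients. *)
Section Relation.
Variables (V W : lmodType R) (Z B : submodClosed V) (Z' B' : submodClosed W).
Variable G : V -> W -> Prop.
Hypothesis Glin : forall a v w v' w',
  G v w -> G v' w' -> G (a *: v + v') (a *: w + w').
Hypothesis GZ : forall v, v \in Z -> exists2 w, w \in Z' & G v w.
Hypothesis GZ' : forall w, w \in Z' -> exists2 v, v \in Z & G v w.
Hypothesis GB : forall v w, v \in Z -> w \in Z' -> G v w -> (v \in B <-> w \in B').

Lemma rel_map_subproof (x : subquot Z B) : exists y : subquot Z' B',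
  exists v w (vZ : v \in Z) (wZ : w \in Z'),
  [/\ x = subquot_class B vZ, y = subquot_class B' wZ & G v w].
Proof.
have [v [vZ ->]] := subquot_class_surj x; have [w wZ vw] := GZ vZ.
by exists (subquot_class B' wZ), v, w, vZ, wZ.
Qed.

Definition rel_map (x : subquot Z B) : subquot Z' B' :=
  sval (cid (rel_map_subproof x)).

(** The chosen related pair and the given one differ by a related pair, and [GB] transfers
    membership of the difference from [B] to [B']. Read backwards, [GB] also yields injectivity. *)
Lemma rel_mapE v w (vZ : v \in Z) (wZ : w \in Z') : G v w ->
  rel_map (subquot_class B vZ) = subquot_class B' wZ.
Proof.
rewrite /rel_map; case: cid => y /= [v1 [w1 [v1Z [w1Z [e -> g1]]]]] g.
apply/esym/subquot_classP; rewrite -GB.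
- exact/(subquot_classP B vZ v1Z).
- exact: submod_rpredB.
- exact: submod_rpredB.
by have := Glin (-1) g1 g; rewrite !scaleN1r (addrC _ v) (addrC _ w).
Qed.

Fact rel_map_linear : linear rel_map.
Proof.
move=> a x y; have [v [vZ ->]] := subquot_class_surj x.
have [v' [vZ' ->]] := subquot_class_surj y.
have [w wZ vw] := GZ vZ; have [w' wZ' vw'] := GZ vZ'.
have h := submod_rpredP a vZ vZ'; have h' := submod_rpredP a wZ wZ'.
rewrite -(subquot_classL B vZ vZ' h) (rel_mapE vZ wZ) // (rel_mapE vZ' wZ') //.
by rewrite (rel_mapE h h') ?(subquot_classL B' wZ wZ' h') //; apply: Glin.
Qed.
HB.instance Definition _ :=
  GRing.isLinear.Build R (subquot Z B) (subquot Z' B') *:%R rel_map rel_map_linear.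

Lemma rel_map_bij : bijective rel_map.
Proof.
have surj y : exists x, rel_map x = y.
  have [w [wZ ->]] := subquot_class_surj y; have [v vZ vw] := GZ' wZ.
  by exists (subquot_class B vZ); apply: (rel_mapE vZ wZ).
have ker0 x : rel_map x = 0 -> x = 0.
  have [v [vZ ->]] := subquot_class_surj x; have [w wZ vw] := GZ vZ.
  rewrite (rel_mapE vZ wZ vw) => /subquot_class0P wB.
  by apply/subquot_class0P; apply/(GB vZ wZ vw).
have inj : injective rel_map by apply: raddf_inj.
exists (fun y => sval (cid (surj y))) => [x|y]; last by case: cid.
by apply: inj; case: cid.
Qed.

Definition subquot_rel_iso : lin_iso (subquot Z B) (subquot Z' B') :=
  @LinIso R _ _ rel_map rel_map_bij.

End Relation.
End Subquotients.

(** * The spectral sequence of a filtered complex *)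

(* The complex is a single ungraded module [V] with a square-zero endomorphism;
   [F p n] stands for the elements of total degree n and filtration at least p.
   This avoids casts between the equal degrees p + q + 1 and
   (p + r) + (q - r + 1). *)
Section FilteredModule.
Variables (R : comPzRingType) (V : lmodType R) (D : {linear V -> V}).
Variable F : int -> int -> submodClosed V.

(* The page r at (p, q) is the quotient of Z_r^{p,q} by
   d Z_{r-1}^{p-r+1,q+r-2} + Z_{r-1}^{p+1,q-1}, with n = p + q. *)
Definition fcycles (r p n : int) : {pred V} :=
  [pred x | (x \in F p n) && (D x \in F (p + r) (n + 1))].

Definition fbounds (r p n : int) : {pred V} :=
  [pred x | `[< exists y z, [/\ y \in fcycles (r - 1) (p - r + 1) (n - 1),
                               z \in fcycles (r - 1) (p + 1) n & x = D y + z] >]].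

Fact fcycles_submod r p n : submod_closed (fcycles r p n).
Proof.
split; first by rewrite inE linear0 !rpred0.
by move=> a x y /andP[x1 x2] /andP[y1 y2]; rewrite inE linearP !submod_rpredP.
Qed.
HB.instance Definition _ r p n :=
  GRing.isSubmodClosed.Build R V (fcycles r p n) (fcycles_submod r p n).

Fact fbounds_submod r p n : submod_closed (fbounds r p n).
Proof.
split.
  by apply/asboolP; exists 0, 0; rewrite !rpred0 linear0 addr0.
move=> a x y /asboolP[u [v [hu hv ->]]] /asboolP[u' [v' [hu' hv' ->]]].
apply/asboolP; exists (a *: u + u'), (a *: v + v').
by rewrite !submod_rpredP // linearP scalerDr addrACA.
Qed.
HB.instance Definition _ r p n :=
  GRing.isSubmodClosed.Build R V (fbounds r p n) (fbounds_submod r p n).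

Lemma fcyclesP r p n x :
  reflect (x \in F p n /\ D x \in F (p + r) (n + 1)) (x \in fcycles r p n).
Proof. exact: andP. Qed.

Lemma fboundsP r p n x :
  reflect (exists y z, [/\ y \in fcycles (r - 1) (p - r + 1) (n - 1),
                           z \in fcycles (r - 1) (p + 1) n & x = D y + z])
          (x \in fbounds r p n).
Proof. exact: asboolP. Qed.

Hypothesis DD : forall x, D (D x) = 0.
Hypothesis F_mono : forall (p p' n n' : int) x,
  p' <= p -> n = n' -> x \in F p n -> x \in F p' n'.

Lemma fcycles_mono r r' p p' n n' x : p' <= p -> p' + r' <= p + r -> n = n' ->
  x \in fcycles r p n -> x \in fcycles r' p' n'.
Proof.
move=> lep lepr <- /fcyclesP[x1 x2].
by apply/fcyclesP; split; [apply: F_mono x1 | apply: F_mono x2].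
Qed.

Lemma fcycles_d r p n n' x : n' = n + 1 ->
  x \in fcycles r p n -> D x \in fcycles r (p + r) n'.
Proof.
move=> -> /fcyclesP[_ x2]; apply/fcyclesP; split=> //.
by rewrite DD rpred0.
Qed.

(** D (D y + z) = D z, and z has filtration p + 1 = (p + r) - r + 1, exactly what a bound at p + r
    asks of its source. *)
Lemma fbounds_d r p n n' x : n' = n + 1 ->
  x \in fbounds r p n -> D x \in fbounds r (p + r) n'.
Proof.
move=> -> /fboundsP[y [z [hy hz ->]]]; apply/fboundsP.
exists z, 0; rewrite linearD DD add0r addr0 rpred0; split=> //.
by apply: fcycles_mono hz; lia.
Qed.

Definition fpage (r : nat) (p q : int) : lmodType R :=
  subquot (fcycles r%:Z p (p + q)) (fbounds r%:Z p (p + q)).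

Fact fpage_degree (r : nat) (p q : int) :
  p + r%:Z + (q - r%:Z + 1) = p + q + 1.
Proof. lia. Qed.

Definition fpage_d (r : nat) (p q : int) :
  {linear fpage r p q -> fpage r (p + r%:Z) (q - r%:Z + 1)} :=
  subquot_map D (fun x => fcycles_d (fpage_degree r p q))
                (fun x => fbounds_d (fpage_degree r p q)).

Lemma fpage_dE r p q x (xZ : x \in fcycles r%:Z p (p + q)) :
  fpage_d r p q (subquot_class _ xZ) =
  subquot_class _ (fcycles_d (fpage_degree r p q) xZ).
Proof. exact: subquot_mapE. Qed.

Lemma fpage_dd r p q x : fpage_d r (p + r%:Z) (q - r%:Z + 1) (fpage_d r p q x) = 0.
Proof.
have [y [yZ ->]] := subquot_class_surj x.
by rewrite !fpage_dE; apply/subquot_class0P; rewrite DD rpred0.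
Qed.

Section NextPage.
Variables (r : nat) (p q : int).
Let p' := p + r%:Z.
Let q' := q - r%:Z + 1.

Let G (u : fpage r p' q') (v : V) :=
  exists vZ : v \in fcycles r%:Z p' (p' + q'), u = subquot_class _ vZ.

Let G_linear a u v u' v' : G u v -> G u' v' -> G (a *: u + u') (a *: v + v').
Proof.
move=> [vZ ->] [vZ' ->]; exists (submod_rpredP a vZ vZ').
by rewrite (subquot_classL _ vZ vZ').
Qed.

(** If d_r kills the class of v, then D v = D y + z with y of filtration p' + 1 and z of filtration
    p' + r + 1. Replacing v by v - y keeps the class on page r and gives the differential z, deep
    enough for page r + 1. *)
Let G_cycles u : u \in ker (fpage_d r p' q') ->
  exists2 v, v \in fcycles r.+1%:Z p' (p' + q') & G u v.
Proof.
have [v [vZ ->]] := subquot_class_surj u => /kerP; rewrite fpage_dE.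
move=> /subquot_class0P/fboundsP[y [z [hy /fcyclesP[z1 z2] e]]].
have /fcyclesP[v1 _] := vZ.
have vyZ : v - y \in fcycles r%:Z p' (p' + q').
  by apply: submod_rpredB => //; apply: fcycles_mono hy; clear; lia.
exists (v - y).
  apply/fcyclesP; split; first by have /fcyclesP[] := vyZ.
  by rewrite linearB e addrAC subrr add0r; apply: F_mono z1; clear; lia.
exists vyZ; apply/subquot_classP; rewrite opprB addrC subrK.
apply/fboundsP; exists 0, y; rewrite linear0 add0r rpred0; split=> //.
by apply: fcycles_mono hy; clear; lia.
Qed.

Let G_lift v : v \in fcycles r.+1%:Z p' (p' + q') ->
  exists2 u, u \in ker (fpage_d r p' q') & G u v.
Proof.
move=> hv; have /fcyclesP[_ v2] := hv.
have vZ : v \in fcycles r%:Z p' (p' + q') by apply: fcycles_mono hv; clear; lia.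
exists (subquot_class _ vZ); last by exists vZ.
apply/kerP; rewrite fpage_dE; apply/subquot_class0P/fboundsP.
exists 0, (D v); rewrite linear0 add0r rpred0; split=> //.
by apply/fcyclesP; rewrite DD rpred0; split=> //; apply: F_mono v2; clear; lia.
Qed.

Let G_bounds u v : u \in ker (fpage_d r p' q') ->
  v \in fcycles r.+1%:Z p' (p' + q') -> G u v ->
  u \in im (fpage_d r p q) <-> v \in fbounds r.+1%:Z p' (p' + q').
Proof.
move=> _ /fcyclesP[v1 v2] [vZ ->]; split.
- move=> /imP[x]; have [y [yZ ->]] := subquot_class_surj x.
  rewrite fpage_dE => /esym/subquot_classP/fboundsP[y' [z [hy hz e]]].
  have /fcyclesP[z1 _] := hz.
  apply/fboundsP; exists (y + y'), z; split.
  + apply: rpredD; first by apply: fcycles_mono yZ; clear; lia.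
    by apply: fcycles_mono hy; clear; lia.
  + apply/fcyclesP; split=> //.
    (* z differs from v by boundaries, so its differential is that of v, which already lies in
       filtration p' + r + 1: this raises z from a cycle of index r - 1 to one of index r. *)
    have -> : D z = D v.
      have -> : z = v - D y - D y' by rewrite e addrAC subrr add0r.
      by rewrite !linearB !DD !subr0.
    by apply: F_mono v2; clear; lia.
  + by rewrite linearD -addrA -e addrC subrK.
- move=> /fboundsP[y [z [hy hz e]]].
  have yZ : y \in fcycles r%:Z p (p + q) by apply: fcycles_mono hy; clear; lia.
  apply/imP; exists (subquot_class _ yZ); rewrite fpage_dE.
  apply/esym/subquot_classP; rewrite e addrAC subrr add0r.
  apply/fboundsP; exists 0, z; rewrite linear0 add0r rpred0; split=> //.
  by apply: fcycles_mono hz; clear; lia.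
Qed.

Definition fpage_iso :
  lin_iso (subquot (ker (fpage_d r p' q')) (im (fpage_d r p q)))
          (fpage r.+1 p' q') :=
  subquot_rel_iso G_linear G_cycles G_lift G_bounds.

End NextPage.

Definition filtered_ss : spectral_sequence R :=
  @SpectralSequence R fpage fpage_d (fun r p q x _ => fpage_dd x)
    (fun r p q _ => fpage_iso r p q).


Section FirstQuadrant.
Hypothesis F_neg : forall (p n : int) x, p <= 0 -> x \in F p n -> x \in F 0 n.
Hypothesis F_big : forall (p n : int) x, n < p -> x \in F p n -> x = 0.

(** For q < 0 the total degree is below p, where the filtration vanishes. For p < 0 the filtration
    is the same at p and at p + 1, so each cycle is its own bound. *)
Lemma filtered_ss_first_quadrant : first_quadrant filtered_ss.
Proof.
move=> r p q _ pq x; have [v [vZ ->]] := subquot_class_surj x.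
have /fcyclesP[v1 v2] := vZ; apply/subquot_class0P.
have [p0|p0] := boolP (p < 0); last first.
  by rewrite (F_big _ v1) ?rpred0 //; move: p0 pq; clear; lia.
apply/fboundsP; exists 0, v; rewrite linear0 add0r rpred0; split=> //.
apply/fcyclesP; split; last by apply: F_mono v2; clear; lia.
have := F_neg _ v1; move=> /(_ (ltac:(move: p0; clear; lia))).
by apply: F_mono => //; move: p0; clear; lia.
Qed.

(** * Convergence to the cohomology of a complex with the same cohomology as the total one *)

Variable X : cochain R.
Variable e : forall n, {linear X n -> V}.
Hypothesis e_F : forall n x, e n x \in F 0 n%:Z.
Hypothesis e_d : forall n x, D (e n x) = e n.+1 (cd X x).
Hypothesis e_surj : forall n y, y \in F 0 n%:Z -> D y = 0 ->
  exists z w, [/\ z \in cocycles X n, w \in F 0 (n%:Z - 1) & y = e n z + D w].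
Hypothesis e_inj : forall n z w, z \in cocycles X n -> w \in F 0 (n%:Z - 1) ->
  e n z = D w -> z \in coboundaries X n.

Let e_coboundary n z : z \in coboundaries X n ->
  exists2 w, w \in F 0 (n%:Z - 1) & e n z = D w.
Proof.
case: n z => [|n] z /=.
  by rewrite inE => /eqP ->; exists 0; rewrite ?rpred0 ?linear0.
move=> /imP[y <-]; exists (e n y); last by rewrite e_d.
by apply: F_mono (e_F y); lia.
Qed.

Let e_cocycle n z : z \in cocycles X n -> D (e n z) = 0.
Proof. by move=> /kerP dz; rewrite e_d dz linear0. Qed.

(** Relates a class of [X] to every total cocycle that represents its image under [e]. Working with
    this relation avoids inverting the map induced on cohomology. *)
Let G n (h : cohomology X n) (v : V) := exists z (zZ : z \in cocycles X n) w,
  [/\ h = subquot_class _ zZ, w \in F 0 (n%:Z - 1) & e n z = v + D w].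

Let G_linear n a (h : cohomology X n) v h' v' :
  G h v -> G h' v' -> G (a *: h + h') (a *: v + v').
Proof.
move=> [z [zZ [w [-> hw ez]]]] [z' [zZ' [w' [-> hw' ez']]]].
exists (a *: z + z'), (submod_rpredP a zZ zZ'), (a *: w + w').
rewrite (subquot_classL _ zZ zZ') submod_rpredP //; split=> //.
by rewrite !linearP ez ez' scalerDr addrACA.
Qed.

Let G_closed n (h : cohomology X n) v : G h v -> D v = 0.
Proof.
move=> [z [zZ [w [_ _ ez]]]]; have := e_cocycle zZ.
by rewrite ez linearD DD addr0.
Qed.

Definition limit_filtration (n p : nat) : {pred cohomology X n} :=
  [pred h | `[< exists2 v, v \in F p%:Z n%:Z & G h v >]].
Arguments limit_filtration : clear implicits.

Fact limit_filtration_submod n p : submod_closed (limit_filtration n p).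
Proof.
split.
  apply/asboolP; exists 0; rewrite ?rpred0 //.
  exists 0, (rpred0 (cocycles X n)), 0; rewrite rpred0 !linear0 addr0.
  by split=> //; apply/esym/subquot_class0P; rewrite rpred0.
move=> a h h' /asboolP[v hv g] /asboolP[v' hv' g']; apply/asboolP.
by exists (a *: v + v'); [apply: submod_rpredP | apply: G_linear].
Qed.
HB.instance Definition _ n p :=
  GRing.isSubmodClosed.Build R (cohomology X n) (limit_filtration n p)
    (limit_filtration_submod n p).

Let filtrationP n p (h : cohomology X n) :
  reflect (exists2 v, v \in F p%:Z n%:Z & G h v) (h \in limit_filtration n p).
Proof. exact: asboolP. Qed.

Section Graded.
Variables p q r : nat.
Hypotheses (lt_pr : (p < r)%N) (lt_qr : (q.+1 < r)%N).

Let G_cycles h : h \in limit_filtration (p + q) p ->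
  exists2 v, v \in fcycles r%:Z p%:Z (p%:Z + q%:Z) & G h v.
Proof.
move=> /filtrationP[v hv g]; exists v => //; apply/fcyclesP.
by rewrite (G_closed g) rpred0; split=> //; apply: F_mono hv; lia.
Qed.

Let G_lift v : v \in fcycles r%:Z p%:Z (p%:Z + q%:Z) ->
  exists2 h, h \in limit_filtration (p + q) p & G h v.
Proof.
move=> /fcyclesP[v1 v2].
(* As q + 1 < r, the degree p + q + 1 is below the filtration p + r, so the cycle condition has
   become D v = 0. *)
have Dv : D v = 0 by apply: F_big v2; move: lt_qr; clear; lia.
have v0 : v \in F 0 (p + q)%N by apply: F_mono v1; clear; lia.
have [z [w [zZ hw ev]]] := e_surj v0 Dv.
have g : G (subquot_class _ zZ) v.
  by exists z, zZ, (- w); rewrite linearN ev addrK -scaleN1r rpredZ.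
by exists (subquot_class _ zZ) => //; apply/filtrationP; exists v.
Qed.

(** As p < r, the index p - r + 1 is at most 0, so sources of boundaries are subject to no
    filtration condition beyond [F 0]. For a closed v, being a bound then means being cohomologous
    to an element of filtration p + 1. *)
Let G_bounds h v : h \in limit_filtration (p + q) p ->
  v \in fcycles r%:Z p%:Z (p%:Z + q%:Z) -> G h v ->
  h \in limit_filtration (p + q) p.+1 <-> v \in fbounds r%:Z p%:Z (p%:Z + q%:Z).
Proof.
move=> _ /fcyclesP[v1 v2] g; have Dv := G_closed g; split.
- have [z1 [zZ1 [w1 [eh hw1 ez1]]]] := g.
  move=> /filtrationP[y hy g2]; have Dy := G_closed g2.
  have [z2 [zZ2 [w2 [eh2 hw2 ez2]]]] := g2.
  have /subquot_classP/e_coboundary[w3 hw3 e12] :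
    subquot_class (coboundaries X (p + q)) zZ1 = subquot_class _ zZ2.
    by rewrite -eh -eh2.
  pose w := w3 + w2 - w1.
  have ev : v = D w + y.
    rewrite linearB linearD -e12 linearB ez1 ez2.
    by rewrite opprD addrA subrK addrAC subrK addrK.
  have hw : w \in F 0 ((p + q)%N%:Z - 1) by rewrite submod_rpredB // rpredD.
  have y1 : y \in F (p%:Z + 1) (p%:Z + q%:Z) by apply: F_mono hy; clear; lia.
  apply/fboundsP; exists w, y; split=> //; apply/fcyclesP; split.
  + by apply: F_mono hw; move: lt_pr; clear; lia.
  + have -> : D w = v - y by rewrite ev addrK.
    by rewrite submod_rpredB //; [apply: F_mono v1|apply: F_mono y1]; clear; lia.
  + exact: y1.
  + by rewrite Dy rpred0.
- move=> /fboundsP[y [z [/fcyclesP[y1 _] /fcyclesP[z1 _] ev]]].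
  have [x [xZ [w [eh hw ex]]]] := g.
  apply/filtrationP; exists z; first by apply: F_mono z1; clear; lia.
  exists x, xZ, (y + w); split=> //; last first.
    by rewrite ex ev linearD addrA [z + _]addrC.
  apply: rpredD => //; have := F_neg _ y1.
  move=> /(_ (ltac:(move: lt_pr; clear; lia))).
  by apply: F_mono; clear; lia.
Qed.

Definition graded_iso :
  lin_iso (subquot (limit_filtration (p + q) p) (limit_filtration (p + q) p.+1))
          (fpage r p q) :=
  subquot_rel_iso (@G_linear (p + q)%N) G_cycles G_lift G_bounds.

End Graded.

Lemma filtered_ss_converges : converges filtered_ss (cohomology X).
Proof.
exists (fun n p => limit_filtration n p : submodClosed (cohomology X n)); split.
- move=> n h; have [z [zZ ->]] := subquot_class_surj h.
  apply/filtrationP; exists (e n z) => //.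
  by exists z, zZ, 0; rewrite rpred0 linear0 addr0.
- move=> n p h /filtrationP[v hv g]; apply/filtrationP; exists v => //.
  by apply: F_mono hv; clear; lia.
- move=> n h /filtrationP[v hv [z [zZ [w [-> hw ez]]]]].
  apply/subquot_class0P; apply: (e_inj zZ hw).
  by rewrite ez (F_big _ hv) ?add0r //; clear; lia.
- by move=> p q r pr qr; constructor; apply: graded_iso.
Qed.

End FirstQuadrant.
End FilteredModule.

(** * Double complexes *)

Section DoubleComplex.
Variables (R : comPzRingType) (A : nat -> nat -> lmodType R).
Variable dh : forall i j, {linear A i j -> A i.+1 j}.
Variable dv : forall i j, {linear A i j -> A i j.+1}.
Hypothesis dhh : forall i j x, dh i.+1 j (dh i j x) = 0.
Hypothesis dvv : forall i j x, dv i j.+1 (dv i j x) = 0.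
Hypothesis dhv : forall i j x, dh i j.+1 (dv i j x) = dv i.+1 j (dh i j x).

Definition tot : lmodType R := dprod (fun i => dprod (fun j => A i j)).

Definition tot_h i j : tot -> A i j :=
  if i is i'.+1 return tot -> A i j then fun x => dh i' j (x i' j) else fun=> 0.

(** [dh] and [dv] commute; the sign makes the squares anticommute, so that the total differential
    squares to zero. *)
Definition tot_v i j : tot -> A i j :=
  if j is j'.+1 return tot -> A i j then fun x => (-1) ^+ i *: dv i j' (x i j')
  else fun=> 0.

Definition tot_d (x : tot) : tot := fun i j => tot_h i j x + tot_v i j x.

Lemma totP (x y : tot) : (forall i j, x i j = y i j) -> x = y.
Proof. by move=> e; apply: dprodP => i; apply: dprodP => j. Qed.

Fact tot_d_linear : linear tot_d.
Proof.
move=> a x y; apply: totP => i j.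
have -> : (a *: tot_d x + tot_d y) i j = a *: tot_d x i j + tot_d y i j by [].
rewrite /tot_d scalerDr addrACA; congr (_ + _).
  case: i => [|i] /=; first by rewrite scaler0 addr0.
  by rewrite -linearP.
case: j => [|j] /=; first by rewrite scaler0 addr0.
by rewrite scalerA mulrC -scalerA -scalerDr -linearP.
Qed.
HB.instance Definition _ :=
  GRing.isLinear.Build R tot tot *:%R tot_d tot_d_linear.

Lemma tot_dd x : tot_d (tot_d x) = 0.
Proof.
apply: totP => i j; rewrite [LHS]/tot_d.
have hh i' : dh i' j (tot_h i' j x) = 0.
  by case: i' => [|i'] /=; rewrite ?linear0 ?dhh.
have vv j' : dv i j' (tot_v i j' x) = 0.
  by case: j' => [|j'] /=; rewrite ?linear0 // linearZZ dvv scaler0.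
case: i vv => [|i] vv; case: j hh => [|j] hh /=;
  rewrite /tot_d ?(linearD (dh _ _)) ?(linearD (dv _ _)) ?hh ?vv.
- by rewrite addr0.
- by rewrite linear0 !add0r scaler0.
- by rewrite linear0 !addr0.
rewrite add0r addr0 linearZZ dhv -scalerDl exprS mulN1r subrr scale0r //.
Qed.

Definition tot_fil (p n : int) : {pred tot} :=
  [pred x : tot | `[< forall i j, (i%:Z < p) || ((i + j)%:Z != n) -> x i j = 0 >]].

Fact tot_fil_submod p n : submod_closed (tot_fil p n).
Proof.
split; first exact/asboolP.
move=> a x y /asboolP hx /asboolP hy; apply/asboolP => i j h.
have -> : (a *: x + y) i j = a *: x i j + y i j by [].
by rewrite hx // hy // scaler0 addr0.
Qed.
HB.instance Definition _ p n :=
  GRing.isSubmodClosed.Build R tot (tot_fil p n) (tot_fil_submod p n).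

Lemma tot_filP p n (x : tot) :
  reflect (forall i j : nat, (i%:Z < p) || ((i + j)%:Z != n) -> x i j = 0)
          (x \in tot_fil p n).
Proof. exact: asboolP. Qed.

Lemma tot_fil_mono (p p' n n' : int) x :
  p' <= p -> n = n' -> x \in tot_fil p n -> x \in tot_fil p' n'.
Proof.
move=> pp <- /tot_filP h; apply/tot_filP => i j hij; apply: h.
by move: pp hij; clear; lia.
Qed.

Lemma tot_fil_neg (p n : int) x : p <= 0 -> x \in tot_fil p n -> x \in tot_fil 0 n.
Proof.
move=> p0 /tot_filP h; apply/tot_filP => i j hij; apply: h.
by move: p0 hij; clear; lia.
Qed.

Lemma tot_fil_big (p n : int) x : n < p -> x \in tot_fil p n -> x = 0.
Proof.
move=> np /tot_filP h; apply: totP => i j; apply: h.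
by move: np; clear; lia.
Qed.

(** In a fixed total degree, a single component separates two consecutive steps of the
    filtration. *)
Lemma tot_fil_succ (p q : nat) (n : int) (x : tot) : n = (p + q)%:Z ->
  x \in tot_fil p n -> x p q = 0 -> x \in tot_fil p.+1 n.
Proof.
move=> -> /tot_filP h xpq; apply/tot_filP => i j hij.
have [[-> ->]//|ne] := pselect (i = p /\ j = q).
by apply: h; move: hij ne; clear; lia.
Qed.

Lemma tot_h0 (i j : nat) (p n : int) x : x \in tot_fil p n -> i%:Z <= p ->
  tot_h i j x = 0.
Proof.
move=> /tot_filP h; case: i => [//|i] ip /=; rewrite h ?linear0 //.
by move: ip; clear; lia.
Qed.

Lemma tot_d_fil (p n n' : int) x : n' = n + 1 ->
  x \in tot_fil p n -> tot_d x \in tot_fil p n'.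
Proof.
move=> -> /tot_filP h; apply/tot_filP => i j hij; rewrite /tot_d.
case: i hij => [|i]; case: j => [|j] hij; rewrite /= ?addr0 ?add0r //.
- by rewrite h ?linear0 ?scaler0 //; move: hij; clear; lia.
- by rewrite h ?linear0 //; move: hij; clear; lia.
by rewrite !h ?linear0 ?scaler0 ?addr0 //; move: hij; clear; lia.
Qed.

Definition single i j (a : A i j) : tot :=
  dfwith (0 : tot) (dfwith (0 : dprod (fun j => A i j)) a).

Lemma single_same i j (a : A i j) : single a i j = a.
Proof. by rewrite /single !dfwith_in. Qed.

Lemma single_out i j (a : A i j) i' j' : (i != i') || (j != j') ->
  single a i' j' = 0.
Proof.
rewrite /single; have [<-{i'}|ne] := eqVneq i i'; last by rewrite dfwith_out.
by rewrite dfwith_in /= => ne; rewrite dfwith_out.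
Qed.

Lemma single_fil i j (a : A i j) (p n : int) :
  p <= i%:Z -> n = (i + j)%:Z -> single a \in tot_fil p n.
Proof.
move=> pi ->; apply/tot_filP => i' j' h; apply: single_out.
by move: pi h; clear; lia.
Qed.

Lemma single_linear i j : linear (@single i j).
Proof.
move=> a x y; apply: totP => i' j'.
have -> : (a *: single x + single y) i' j' = a *: single x i' j' + single y i' j'.
  by [].
have [[<- <-]|ne] := pselect (i = i' /\ j = j'); first by rewrite !single_same.
have {}ne : (i != i') || (j != j') by move: ne; clear; lia.
by rewrite !(single_out _ ne) scaler0 addr0.
Qed.
HB.instance Definition _ i j :=
  GRing.isLinear.Build R (A i j) tot *:%R (@single i j) (@single_linear i j).

Definition tot_ss : spectral_sequence R :=
  @filtered_ss R tot tot_d tot_fil tot_dd tot_fil_mono.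

Lemma tot_ss_first_quadrant : first_quadrant tot_ss.
Proof.
exact: (@filtered_ss_first_quadrant R tot tot_d tot_fil tot_dd tot_fil_mono
  tot_fil_neg tot_fil_big).
Qed.

(** * Total cohomology when the rows are resolutions *)

Section Augmented.
Variables (X : cochain R) (eps : forall j, {linear X j -> A 0 j}).
Hypothesis eps_d : forall j x, eps j.+1 (cd X x) = dv 0 j (eps j x).
Hypothesis dh_eps : forall j x, dh 0 j (eps j x) = 0.
Hypothesis eps_inj : forall j x, eps j x = 0 -> x = 0.
Hypothesis exact0 : forall j y, dh 0 j y = 0 -> exists x, eps j x = y.
Hypothesis exactS : forall i j y, dh i.+1 j y = 0 -> exists x, dh i j x = y.

Definition tot_eps n (x : X n) : tot := single (eps n x).

Fact tot_eps_linear n : linear (@tot_eps n).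
Proof. by move=> a x y; rewrite /tot_eps !linearP. Qed.
HB.instance Definition _ n :=
  GRing.isLinear.Build R (X n) tot *:%R (@tot_eps n) (@tot_eps_linear n).

Lemma tot_eps_fil n x : @tot_eps n x \in tot_fil 0 n%:Z.
Proof. exact: single_fil. Qed.

Lemma tot_eps_d n x : tot_d (@tot_eps n x) = tot_eps (cd X x).
Proof.
apply: totP => i j; rewrite /tot_d /tot_eps eps_d.
have [[-> ->]|ne] := pselect (i = 0%N /\ j = n.+1).
  by rewrite /= !single_same add0r expr0 scale1r.
rewrite [RHS]single_out; last by move: ne; clear; lia.
case: i ne => [|i] ne; case: j ne => [|j] ne /=; rewrite ?add0r ?addr0 //.
- by rewrite single_out ?linear0 ?scaler0 //; move: ne; clear; lia.
- case: i ne => [|i] ne; last by rewrite single_out ?linear0.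
  case: n x ne => [|n] x ne; first by rewrite single_same dh_eps.
  by rewrite single_out ?linear0.
rewrite [single _ i.+1 _]single_out // linear0 scaler0 addr0.
have [[-> ej]|ne2] := pselect (i = 0%N /\ n = j.+1).
  by case: _ / (ej) in x ne *; rewrite single_same dh_eps.
by rewrite single_out ?linear0 //; move: ne2; clear; lia.
Qed.

(* Exactness of the rows lets one clear the components of [y] with first index
   k, ..., 1 one after the other. *)
Lemma tot_push_to_row0 (k n : nat) (y : tot) : y \in tot_fil 0 n%:Z ->
  (forall i j, (k < i)%N -> y i j = 0) ->
  (forall i j, tot_d y i.+1 j = 0) ->
  exists2 w, w \in tot_fil 0 (n%:Z - 1) &
    forall i j, (y - tot_d w) i.+1 j = 0.
Proof.
elim: k y => [|k IHk] y yF yk dy.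
  by exists 0; rewrite ?rpred0 // linear0 subr0 => i j; apply: yk.
have /tot_filP y0 := yF.
have [kn|nk] := leqP k.+1 n; last first.
  apply: IHk => // i j ki; apply: y0; move: ki nk; clear; lia.
pose j := (n - k.+1)%N.
(* [y] has no component of first index above k + 1, so the component (k + 2, j) of [tot_d y], which
   vanishes, is [dh] of the component (k + 1, j). *)
have [u du] : exists u, dh k j u = y k.+1 j.
  apply: exactS; have := dy k.+1 j; rewrite /tot_d /=.
  suff -> : tot_v k.+2 j y = 0 by rewrite addr0.
  by case: (j) => [//|j'] /=; rewrite yk ?linear0 ?scaler0.
have sF : single u \in tot_fil 0 (n%:Z - 1).
  by apply: single_fil => //; rewrite /j; move: kn; clear; lia.
have dsF : tot_d (single u) \in tot_fil 0 n%:Z.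
  by apply: tot_d_fil sF; clear; lia.
have [|i j' ki|i j'|w wF hw] := IHk (y - tot_d (single u)).
- exact: submod_rpredB.
- have -> : (y - tot_d (single u)) i j' = y i j' - tot_d (single u) i j' by [].
  have [[ei ej]|ne] := pselect (i = k.+1 /\ j' = j).
    rewrite ei ej /tot_d /= single_same du.
    suff -> : tot_v k.+1 j (single u) = 0 by rewrite addr0 subrr.
    by case: (j) u {du sF dsF} => [//|j1] u /=;
      rewrite single_out ?linear0 ?scaler0 //; clear; lia.
  have [eij|nij] := eqVneq (i + j')%N n.
    rewrite yk; last by move: ki ne eij; rewrite /j; clear; lia.
    case: i ki ne eij => [//|i] ki ne eij; rewrite /tot_d /=.
    rewrite single_out ?linear0; last by move: ki ne eij; rewrite /j; clear; lia.
    case: j' ne eij => [|j'] ne eij /=; first by rewrite addr0 subr0.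
    rewrite single_out ?linear0 ?scaler0 ?addr0 ?subr0 //.
    by move: ki; clear; lia.
  rewrite y0; last by move: nij; clear; lia.
  move/tot_filP: dsF => ->; rewrite ?subr0 //; move: nij; clear; lia.
- have -> : tot_d (y - tot_d (single u)) = tot_d y by rewrite linearB /= tot_dd subr0.
  exact: dy.
exists (single u + w); first exact: rpredD.
have -> : y - tot_d (single u + w) = y - tot_d (single u) - tot_d w.
  by rewrite (linearD tot_d) opprD addrA.
exact: hw.
Qed.

(** The differential of [y] is required to vanish only away from first index 0. This covers total
    cocycles as well as an element whose differential is some [tot_eps z], so surjectivity and
    injectivity on cohomology both follow from it. *)
Lemma tot_row0 (n : nat) (y : tot) : y \in tot_fil 0 n%:Z ->
  (forall i j, tot_d y i.+1 j = 0) ->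
  exists z w, w \in tot_fil 0 (n%:Z - 1) /\ y = @tot_eps n z + tot_d w.
Proof.
move=> yF dy; have /tot_filP y0 := yF.
have [|w wF hw] := @tot_push_to_row0 n n y yF _ dy.
  by move=> i j ni; apply: y0; move: ni; clear; lia.
have y'F : y - tot_d w \in tot_fil 0 n%:Z.
  by apply: submod_rpredB => //; apply: tot_d_fil wF; clear; lia.
have [z ez] : exists z, eps n z = (y - tot_d w) 0%N n.
  apply: exact0; have := dy 0%N n.
  have -> : tot_d y = tot_d (y - tot_d w) by rewrite linearB /= tot_dd subr0.
  rewrite /tot_d /=; suff -> : tot_v 1 n (y - tot_d w) = 0 by rewrite addr0.
  by case: (n) => [//|m] /=; rewrite hw linear0 scaler0.
exists z, w; split=> //; apply/eqP; rewrite -subr_eq; apply/eqP.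
apply: totP => i j; rewrite /tot_eps ez.
have [[-> ->]|ne] := pselect (i = 0%N /\ j = n); first by rewrite single_same.
rewrite [RHS]single_out; last by move: ne; clear; lia.
case: i ne => [|i] ne; last exact: hw.
by move/tot_filP: y'F => -> //; move: ne; clear; lia.
Qed.

Lemma tot_eps_eq0 n (x : X n) : tot_eps x = 0 -> x = 0.
Proof.
move=> ex; apply: eps_inj; rewrite -[LHS]single_same -/(tot_eps x) ex.
by [].
Qed.

Lemma tot_eps_surj (n : nat) y : y \in tot_fil 0 n%:Z -> tot_d y = 0 ->
  exists z w, [/\ z \in cocycles X n, w \in tot_fil 0 (n%:Z - 1) &
                  y = @tot_eps n z + tot_d w].
Proof.
move=> yF dy; have [|z [w [wF ey]]] := tot_row0 yF; first by rewrite dy.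
exists z, w; split=> //; apply/kerP; apply: tot_eps_eq0.
by rewrite -tot_eps_d; move: dy; rewrite ey linearD /= tot_dd addr0.
Qed.

Lemma tot_eps_coboundary (n : nat) z w : z \in cocycles X n ->
  w \in tot_fil 0 (n%:Z - 1) -> @tot_eps n z = tot_d w -> z \in coboundaries X n.
Proof.
case: n z => [|n] z zZ wF ez.
  rewrite /= inE; apply/eqP/tot_eps_eq0.
  by rewrite ez (tot_fil_big _ wF) ?linear0.
have {}wF : w \in tot_fil 0 n%:Z by apply: tot_fil_mono wF; clear; lia.
have [|z' [u [uF ew]]] := tot_row0 wF.
  by move=> i j; rewrite -ez /tot_eps single_out.
apply/imP; exists z'; apply/eqP; rewrite -subr_eq0; apply/eqP/tot_eps_eq0.
by rewrite linearB /= -tot_eps_d ez ew (linearD tot_d) /= tot_dd addr0 subrr.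
Qed.

Lemma tot_ss_converges : converges tot_ss (cohomology X).
Proof.
exact: (@filtered_ss_converges R tot tot_d tot_fil tot_dd tot_fil_mono
  tot_fil_neg tot_fil_big X (fun n => @tot_eps n) tot_eps_fil tot_eps_d
  tot_eps_surj tot_eps_coboundary).
Qed.

End Augmented.

(* [G a b] says that the vertical cocycle [a] represents [b]: the complex
   [Y q] is the vertical cohomology in degree q. *)
Section SecondPage.
Variables (Y : nat -> cochain R) (G : forall p q, A p q -> Y q p -> Prop).

Definition is_boundary p q : A p q -> Prop :=
  if q is q'.+1 return A p q -> Prop then fun a => exists c, dv p q' c = a
  else fun a => a = 0.

Hypothesis G_linear : forall p q c (a : A p q) b a' b',
  G a b -> G a' b' -> G (c *: a + a') (c *: b + b').
Hypothesis G_closed : forall p q (a : A p q) b, G a b -> dv p q a = 0.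
Hypothesis G_class : forall p q (a : A p q), dv p q a = 0 -> exists b, G a b.
Hypothesis G_lift : forall p q (b : Y q p), exists a : A p q, G a b.
Hypothesis G_boundary : forall p q (a : A p q) b, G a b -> b = 0 <-> is_boundary a.
Hypothesis G_d : forall p q (a : A p q) b, G a b -> G (dh p q a) (cd (Y q) b).

Lemma relation_sub p q (a : A p q) b a' b' : G a b -> G a' b' -> G (a - a') (b - b').
Proof.
by move=> g g'; have := G_linear (-1) g' g; rewrite !scaleN1r ![- _ + _]addrC.
Qed.

Lemma is_boundary_lift p q (a : A p q) (n : int) : n = (p + q)%:Z ->
  is_boundary a ->
  exists2 w, w \in tot_fil p (n - 1) & tot_d w p q = a.
Proof.
case: q a => [|q] a en /= => [->|[c <-]].
  by exists 0; rewrite ?rpred0 ?linear0.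
have sF : single ((-1) ^+ p *: c) \in tot_fil p (n - 1).
  by apply: single_fil => //; move: en; clear; lia.
exists (single ((-1) ^+ p *: c)) => //; rewrite /tot_d (tot_h0 _ sF) // add0r /=.
by rewrite single_same linearZZ signrZK.
Qed.

Lemma relation_0 p q : G (0 : A p q) 0.
Proof. by have [a g] := G_lift (0 : Y q p); have := relation_sub g g; rewrite !subrr. Qed.

(** Since D y has filtration p, the component (p - 1, q) of y is a vertical cocycle; it represents
    some element of [Y q], and its horizontal image represents the differential of that element. For
    p = 0 there is no such component and both sides are 0. *)
Lemma coboundary_of_fil p q (n : int) y : n = (p + q)%:Z ->
  y \in tot_fil (p%:Z - 1) (n - 1) -> tot_d y \in tot_fil p n ->
  exists2 b, b \in coboundaries (Y q) p & G (tot_h p q y) b.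
Proof.
case: p => [|p] en yF dyF.
  by exists 0; [apply: rpred0 | apply: relation_0].
have dy0 : dv p q (y p q) = 0.
  have dy0 : tot_d y p q.+1 = 0.
    by move/tot_filP: dyF; apply; move: en; clear; lia.
  rewrite -[LHS](signrZK p); move: dy0.
  have pp : p%:Z <= p.+1%:Z - 1 by clear; lia.
  by rewrite /tot_d (tot_h0 _ yF pp) // add0r /= => ->; rewrite scaler0.
have [b g] := G_class dy0; exists (cd (Y q) b); last exact: G_d.
by apply/imP; exists b.
Qed.

Lemma fil_of_coboundary p q (n : int) b : n = (p + q)%:Z ->
  b \in coboundaries (Y q) p ->
  exists y, [/\ y \in tot_fil (p%:Z - 1) (n - 1), tot_d y \in tot_fil p n &
                G (tot_d y p q) b].
Proof.
case: p b => [|p] b en /=.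
  rewrite inE => /eqP ->; exists 0; rewrite linear0 !rpred0; split=> //.
  exact: relation_0.
move=> /imP[b' <-]; have [a g] := G_lift b'; exists (single a).
have sF : single a \in tot_fil (p.+1%:Z - 1) (n - 1).
  by apply: single_fil; move: en; clear; lia.
split=> //; last first.
  rewrite /tot_d /= single_same.
  suff -> : tot_v p.+1 q (single a) = 0 by rewrite addr0; apply: G_d.
  case: (q) a {b b' en g sF} => [//|q'] a /=.
  by rewrite single_out ?linear0 ?scaler0 //; clear; lia.
apply: (@tot_fil_succ p q.+1); first by move: en; clear; lia.
  have := tot_d_fil (esym (subrK 1 n)) sF.
  by apply: tot_fil_mono => //; clear; lia.
have pp : p%:Z <= p.+1%:Z - 1 by clear; lia.
by rewrite /tot_d (tot_h0 _ sF pp) /= single_same (G_closed g) scaler0 addr0.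
Qed.

Variables p q : nat.
Let n := p%:Z + q%:Z.
Let Gv (v : tot) (b : Y q p) := G (v p q) b.

Let Gv_linear a v b v' b' : Gv v b -> Gv v' b' -> Gv (a *: v + v') (a *: b + b').
Proof. exact: G_linear. Qed.

(** Two components of [tot_d v] vanish: (p, q + 1) says that the corner of v is vertically closed,
    and (p + 1, q) says that [dh] of the corner cancels a vertical boundary. *)
Lemma fcycles2P v : v \in fcycles tot_d tot_fil 2 p n ->
  dv p q (v p q) = 0 /\ is_boundary (dh p q (v p q)).
Proof.
move=> /fcyclesP[vF /tot_filP dv0].
have dv1 : tot_d v p q.+1 = 0 by apply: dv0; clear; lia.
have dv2 : tot_d v p.+1 q = 0 by apply: dv0; clear; lia.
split.
  rewrite -[LHS](signrZK p); move: dv1.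
  by rewrite /tot_d (tot_h0 _ vF) // add0r /= => ->; rewrite scaler0.
move/eqP: dv2; rewrite /tot_d /= addr_eq0 => /eqP ->.
case: (q) => [|q'] /=; first by rewrite oppr0.
by exists (- ((-1) ^+ p.+1 *: v p.+1 q')); rewrite linearN linearZZ.
Qed.

Let Gv_cycles v : v \in fcycles tot_d tot_fil 2 p n ->
  exists2 b, b \in cocycles (Y q) p & Gv v b.
Proof.
move=> /fcycles2P[dv0 hb]; have [b g] := G_class dv0; exists b => //.
by apply/kerP; apply/(G_boundary (G_d g)).
Qed.

(** The zigzag: as the differential of b is 0, [dh a] is a vertical boundary and is cancelled by
    some w of filtration p + 1. The differential of [single a - w] then vanishes at (p, q + 1) and
    (p + 1, q), hence has filtration p + 2. *)
Let Gv_lift b : b \in cocycles (Y q) p ->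
  exists2 v, v \in fcycles tot_d tot_fil 2 p n & Gv v b.
Proof.
move=> /kerP db; have [a g] := G_lift b.
have /(G_boundary (G_d g)) hb := db.
have [|w wF dw] := @is_boundary_lift p.+1 q (dh p q a) (n + 1) _ hb.
  by rewrite /n; clear; lia.
have {}wF : w \in tot_fil p.+1 n by apply: tot_fil_mono wF; clear; lia.
have sF : single a \in tot_fil p n by apply: single_fil => //; clear; lia.
have vF : single a - w \in tot_fil p n.
  by apply: submod_rpredB => //; apply: tot_fil_mono wF; clear; lia.
have dvF : tot_d (single a - w) \in tot_fil p (n + 1) by apply: tot_d_fil vF.
have E i j : tot_d (single a - w) i j = tot_d (single a) i j - tot_d w i j.
  by rewrite linearB.
have vpq : (single a - w) p q = a.
  have -> : (single a - w) p q = single a p q - w p q by [].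
  by rewrite single_same; move/tot_filP: wF => ->; rewrite ?subr0 //; clear; lia.
exists (single a - w); last by rewrite /Gv vpq.
apply/fcyclesP; split=> //.
have {}dvF : tot_d (single a - w) \in tot_fil p.+1 (n + 1).
  apply: (@tot_fil_succ p q.+1) => //; first by rewrite /n; clear; lia.
  by rewrite /tot_d (tot_h0 _ vF) //= vpq (G_closed g) scaler0 addr0.
have : tot_d (single a - w) \in tot_fil p.+2 (n + 1).
  apply: (@tot_fil_succ p.+1 q) => //; first by rewrite /n; clear; lia.
  rewrite E dw /tot_d /= single_same.
  suff -> : tot_v p.+1 q (single a) = 0 by rewrite addr0 subrr.
  case: (q) a {g hb dw sF vF dvF E vpq} => [//|q'] a /=.
  by rewrite single_out ?linear0 ?scaler0 //; clear; lia.
by apply: tot_fil_mono; clear; lia.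
Qed.

(** Modulo filtration p + 1, the equation v = D y says that the corner of v is [dh] of y at (p - 1,
    q) plus, up to sign, [dv] of y at (p, q - 1). The first term represents a coboundary of [Y q],
    the second represents 0. *)
Let Gv_bounds v b : v \in fcycles tot_d tot_fil 2 p n ->
  b \in cocycles (Y q) p -> Gv v b ->
  v \in fbounds tot_d tot_fil 2 p n <-> b \in coboundaries (Y q) p.
Proof.
move=> /fcyclesP[vF dvF] _ g; split.
- move=> /fboundsP[y [z [/fcyclesP[yF dyF] /fcyclesP[/tot_filP zF _] ev]]].
  have {}yF : y \in tot_fil (p%:Z - 1) (n - 1).
    by apply: tot_fil_mono yF; clear; lia.
  have {}dyF : tot_d y \in tot_fil p n.
    by apply: tot_fil_mono dyF; clear; lia.
  have [b' b'B g'] := coboundary_of_fil (erefl : n = (p + q)%:Z) yF dyF.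
  suff /(G_boundary (relation_sub g g')) : is_boundary (v p q - tot_h p q y).
    by move=> /eqP; rewrite subr_eq0 => /eqP ->.
  have -> : v p q - tot_h p q y = tot_v p q y.
    have -> : v p q = tot_d y p q + z p q by rewrite ev.
    rewrite zF; last by clear; lia.
    by rewrite addr0 /tot_d addrAC subrr add0r.
  case: (q) => [//|q'] /=; exists ((-1) ^+ p *: y p q').
  by rewrite linearZZ.
- move=> bB; have [y [yF dyF gy]] := fil_of_coboundary (erefl : n = (p + q)%:Z) bB.
  have gb := relation_sub g gy; rewrite subrr in gb.
  have /(is_boundary_lift (erefl : n = (p + q)%:Z)) [w wF dw] :
    is_boundary (v p q - tot_d y p q) by apply/(G_boundary gb).
  have dwF : tot_d w \in tot_fil p n by apply: tot_d_fil wF; clear; lia.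
  have zF : v - tot_d (y + w) \in tot_fil p.+1 n.
    apply: (@tot_fil_succ p q) => //.
      by rewrite (linearD tot_d); apply: submod_rpredB => //; apply: rpredD.
    rewrite (linearD tot_d) opprD addrA.
    by rewrite -[RHS](subrr (tot_d w p q)) {1}dw.
  apply/fboundsP; exists (y + w), (v - tot_d (y + w)); split.
  + apply/fcyclesP; split.
      apply: rpredD; first by apply: tot_fil_mono yF; clear; lia.
      by apply: tot_fil_mono wF; clear; lia.
    rewrite linearD; apply: rpredD.
      by apply: tot_fil_mono dyF; clear; lia.
    by apply: tot_fil_mono dwF; clear; lia.
  + apply/fcyclesP; split; first by apply: tot_fil_mono zF; clear; lia.
    rewrite linearB /= tot_dd subr0.
    by apply: tot_fil_mono dvF; clear; lia.
  + by rewrite addrC subrK.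
Qed.

Definition second_page_iso :
  lin_iso (tot_ss 2%N p q) (cohomology (Y q) p) :=
  subquot_rel_iso Gv_linear Gv_cycles Gv_lift Gv_bounds.

End SecondPage.
End DoubleComplex.

(** * Cochains of the comma categories *)

Section CommaCochains.
Variables (R : comPzRingType) (C D : category) (phi : functor C D).
Variable M : coef_system R (nerve C).

Lemma simplices_eq_id n (s : nerve C n) (e : s = s) (x : M (simplex s)) :
  mmap M (simplices_eq e) x = x.
Proof.
rewrite -[RHS](mmap_id (r := M)); congr (mmap M _ _).
exact: eq_exist.
Qed.

Lemma simplices_eq_trans n (s t r : nerve C n) (e1 : s = t) (e2 : t = r)
    (x : M (simplex s)) :
  mmap M (simplices_eq e2) (mmap M (simplices_eq e1) x) =
  mmap M (simplices_eq (etrans e1 e2)) x.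
Proof. by subst t r; rewrite !simplices_eq_id. Qed.

(** Simplices of nerves that agree in content are equal only propositionally, so values of [z] are
    compared in a common module [M] s. Once the equalities are eliminated, what remains are loops,
    which [M] sends to identities by proof irrelevance. *)
Lemma comma_coef_eq n (d : D) (z : gz_ob (comma_coef phi M d) n)
    (t' t : nerve (comma phi d) n) (s : nerve C n)
    (e' : nerve_map (comma_forget phi d) n t' = s)
    (e : nerve_map (comma_forget phi d) n t = s) : t' = t ->
  mmap M (simplices_eq e') (z t') = mmap M (simplices_eq e) (z t).
Proof. by move=> et; subst t' s; rewrite !simplices_eq_id. Qed.

Section Restriction.
Variables (d d' : D) (beta : Hom d d').

(** The map on cochains behind [Hth_comma_map]; it unfolds to [gz_pull] followed by [gz_coef], from
    which it inherits compatibility with the differentials. *)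
Definition comma_res n (z : gz_ob (comma_coef phi M d') n) :
    gz_ob (comma_coef phi M d) n :=
  fun s => mmap M (simplices_eq (nerve_comma_push beta s))
             (z (nerve_map (comma_push phi beta) n s)).

Fact comma_res_linear n : linear (@comma_res n).
Proof. by move=> a x y; apply: dprodP => s; rewrite /comma_res linearP. Qed.
HB.instance Definition _ n :=
  GRing.isLinear.Build R (gz_ob (comma_coef phi M d') n)
    (gz_ob (comma_coef phi M d) n) *:%R (@comma_res n) (@comma_res_linear n).

Lemma comma_res_d n (z : gz_ob (comma_coef phi M d') n) :
  comma_res (@cd R (gz_cochain (comma_coef phi M d')) n z) =
  @cd R (gz_cochain (comma_coef phi M d)) n (comma_res z).
Proof.
pose u :=
  cosimp_map (gz_pull (nerve_map (comma_push phi beta)) (comma_coef phi M d')).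
pose v := cosimp_map (gz_coef (comma_coef_id phi M beta)).
exact: etrans (congr1 (v n.+1) (cmapd u z)) (cmapd v (u n z)).
Qed.

End Restriction.

Lemma comma_res_id d n (z : gz_ob (comma_coef phi M d) n) :
  comma_res (idc d) z = z.
Proof.
apply: dprodP => s; rewrite -[RHS](simplices_eq_id erefl).
exact: comma_coef_eq (comma_push_id s).
Qed.

Lemma comma_res_comp (d d' d'' : D) (g : Hom d' d) (f : Hom d'' d') n
    (z : gz_ob (comma_coef phi M d) n) :
  comma_res (comp g f) z = comma_res f (comma_res g z).
Proof.
apply: dprodP => s.
apply: (etrans _ (esym (simplices_eq_trans
  (@nerve_comma_push C D phi d' d g n (nerve_map (comma_push phi f) n s))
  (nerve_comma_push f s) _))).
exact: comma_coef_eq (comma_push_comp g f s).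
Qed.

Definition comma_cochains (n : nat) : rmod R (op D) :=
  @RMod R (op D) (fun d : D => gz_ob (comma_coef phi M d) n)
    (fun d' d beta => @comma_res d d' beta n)
    (fun d z => comma_res_id z) (fun d d' d'' g f z => comma_res_comp f g z).

Definition comma_d (n : nat) : rmod_hom (comma_cochains n) (comma_cochains n.+1) :=
  @RModHom R (op D) (comma_cochains n) (comma_cochains n.+1)
    (fun (d : D) z => @cd R (gz_cochain (comma_coef phi M d)) n z)
    (fun d => @linearP R _ _ _ (@cd R (gz_cochain (comma_coef phi M d)) n))
    (fun d' d beta z => esym (comma_res_d beta z)).

End CommaCochains.

(** A form of projectivity in which [p] only has to reach the image of [g]. It will be applied to
    the differential [comma_d], which is not surjective. *)
Lemma free_cover_lift (R : comPzRingType) (E : category) (F A B : rmod R E)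
    (p : rmod_hom A B) (g : rmod_hom (free_cover F) B) :
  (forall e x, exists y, p e y = g e x) ->
  exists h : rmod_hom (free_cover F) A, rhom_comp p h = g.
Proof.
move=> pg; pose gen a (u : F a) : free_cover F a := fvar R (existT _ a (u, idc a)).
pose l a u := cid (pg a (gen a u)).
pose h e := fext (fun s : cover_gen F e =>
  mmap A (projT2 s).2 (sval (l _ (projT2 s).1))).
have h_nat a b (f : Hom a b) x :
    h b (mmap (free_cover F) f x) = mmap A f (h a x).
  move: x; apply: freemod_ext => [||[e [u k]]].
  - by move=> k x y; rewrite /h !linearP.
  - by move=> k x y; rewrite /h !linearP.
  by rewrite /h /= !fext_var /= mmap_comp.
have h_lin e : linear (h e) by exact: fext_linear.
exists (@RModHom R E (free_cover F) A h h_lin h_nat).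
apply: rmod_homP => e; apply: freemod_ext => [||[a [u k]]].
- by move=> k x y; rewrite /h !linearP.
- by move=> k x y; rewrite /h !linearP.
rewrite /= /h fext_var /= rhom_nat (svalP (l a u)) -rhom_nat /gen /= fext_var.
by rewrite /cover_push /= compf1.
Qed.

Section Postcomposition.
Variables (R : comPzRingType) (E : category) (A B B' : rmod R E).

Definition rhom_post (f : rmod_hom B B') (g : rmod_hom A B) : rmod_hom A B' :=
  rhom_comp f g.

Fact rhom_post_linear (f : rmod_hom B B') : linear (rhom_post f).
Proof. by move=> a g h; apply: rmod_homP => e x; rewrite /= linearP. Qed.
HB.instance Definition _ (f : rmod_hom B B') :=
  GRing.isLinear.Build R (rmod_hom A B) (rmod_hom A B') *:%R (rhom_post f)
    (rhom_post_linear f).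

End Postcomposition.

(** * Morphisms from a free module into cochains and into their cohomology *)

Section CommaCohomology.
Variables (R : comPzRingType) (C D : category) (phi : functor C D).
Variable M : coef_system R (nerve C).

Definition represents (A : rmod R (op D)) q
    (f : rmod_hom A (comma_cochains phi M q)) (g : rmod_hom A (Hth_comma phi M q)) :=
  forall (d : op D) x,
    exists fx : f d x \in cocycles (gz_cochain (comma_coef phi M d)) q,
      g d x = subquot_class (coboundaries _ q) fx.

Lemma represents_exists (A : rmod R (op D)) q
    (f : rmod_hom A (comma_cochains phi M q)) :
  rhom_post (comma_d phi M q) f = 0 -> exists g, represents f g.
Proof.
move=> df.
have fZ (d : op D) x : f d x \in cocycles (gz_cochain (comma_coef phi M d)) q.
  apply/kerP.
  by have e := congr1 (fun h : rmod_hom A (comma_cochains phi M q.+1) => h d x) df.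
pose g (d : op D) x : Hth_comma phi M q d :=
  subquot_class (coboundaries (gz_cochain (comma_coef phi M d)) q) (fZ d x).
have g_lin (d : op D) : linear (g d).
  move=> a x y; rewrite -(subquot_classL _ _ _ (submod_rpredP a (fZ d x) (fZ d y))).
  by apply: subquot_class_eq; rewrite linearP.
have g_nat (d' d : op D) (b : Hom d' d) x :
    g d (mmap A b x) = mmap (Hth_comma phi M q) b (g d' x).
  have [hw e] := @Hth_comma_mapE R C D phi M d d' b q _ (fZ d' x).
  by rewrite [RHS]e; apply: subquot_class_eq; rewrite rhom_nat.
exists (@RModHom R (op D) A (Hth_comma phi M q) g g_lin g_nat) => d x.
by exists (fZ d x).
Qed.

Lemma represents_linear (A : rmod R (op D)) q a f g f' g' :
  @represents A q f g -> represents f' g' ->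
  represents (a *: f + f') (a *: g + g').
Proof.
move=> fg fg' d x; have [fx e] := fg d x; have [fx' e'] := fg' d x.
exists (submod_rpredP a fx fx').
have -> : (a *: g + g') d x = a *: g d x + g' d x by [].
by rewrite e e' (subquot_classL _ fx fx').
Qed.

Lemma represents_closed (A : rmod R (op D)) q f g :
  @represents A q f g -> rhom_post (comma_d phi M q) f = 0.
Proof.
move=> fg; apply: rmod_homP => d x; have [fx _] := fg d x.
by move/kerP: fx => dfx; exact dfx.
Qed.

(** [g] = 0 only says that each value of [f] is a coboundary; freeness of the source lets the
    primitives be chosen as a morphism of modules. *)
Lemma represents_boundary (F : rmod R (op D)) q f g :
  @represents (free_cover F) q f g ->
  g = 0 <->
  (if q is q'.+1 return rmod_hom (free_cover F) (comma_cochains phi M q) -> Prop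
   then fun f => exists c, rhom_post (comma_d phi M q') c = f
   else fun f => f = 0) f.
Proof.
move=> fg; have g0 : g = 0 <->
    forall (d : op D) x, f d x \in coboundaries (gz_cochain (comma_coef phi M d)) q.
  split=> [g0 d x|fB].
    have [fx e] := fg d x; apply/(subquot_class0P _ fx).
    have gdx : g d x = 0 := congr1 (fun h : rmod_hom _ _ => h d x) g0.
    rewrite -e; exact gdx.
  apply: rmod_homP => d x; have [fx ->] := fg d x.
  by apply/subquot_class0P; apply: fB.
rewrite g0; case: q f g fg {g0} => [|q] f g _.
  split=> [fB|-> d x]; last exact: rpred0.
  by apply: rmod_homP => d x; have := fB d x; rewrite inE => /eqP.
split=> [fB|[c <-] d x]; last by apply/imP; exists (c d x).
have [|c ec] := @free_cover_lift R (op D) F _ _ (comma_d phi M q) f.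
  by move=> d x; have /imP := fB d x.
by exists c.
Qed.

(** The inclusion of the module of cocycles represents the map [p] that takes classes. This map is
    onto, so [g] lifts along it, and the lift followed by the inclusion represents [g]. *)
Lemma represents_lift (F : rmod R (op D)) q g :
  exists f, @represents (free_cover F) q f g.
Proof.
have [|p hp] := @represents_exists _ q (rker_incl (comma_d phi M q)).
  apply: rmod_homP => d [x xZ].
  by have /kerP dx := xZ; exact dx.
have p_surj : rmod_surj p.
  move=> d y; have [z [zZ ->]] := subquot_class_surj y.
  pose u : rker (comma_d phi M q) d :=
    @Submodule _ _ (rker_ob (comma_d phi M q) d) z zZ.
  by exists u; have [h ->] := hp d u; apply: subquot_class_eq.
have [h <-] := free_cover_proj g p_surj.
exists (rhom_comp (rker_incl (comma_d phi M q)) h) => d x.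
exact: (hp d (h d x)).
Qed.

End CommaCohomology.

(** * Exactness of the rows *)

Section SplitResolution.
Variables (R : comPzRingType) (E : category).

Lemma freemod_lift (X : Type) (U W : lmodType R) (p : {linear U -> W})
    (g : {linear freemod R X -> W}) :
  (forall y, exists x, p x = y) ->
  exists h : {linear freemod R X -> U}, forall x, p (h x) = g x.
Proof.
move=> p_surj; exists (fext (fun x => sval (cid (p_surj (g (fvar R x)))))).
apply: freemod_ext => [a x y|a x y|x]; rewrite ?linearP //.
by rewrite /= fext_var; case: cid.
Qed.

Section Splitting.
Variables (F : rmod R E) (e : E).

(* Each syzygy is an R-linear retract of the free module that covers the
   previous one, so a splitting of the augmentation propagates upwards. *)
Definition splits (n : nat) : Prop :=
  exists s : {linear syzygy F n e -> free_cover (syzygy F n) e},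
    forall x, cover_map (syzygy F n) e (s x) = x.

(** x - s (c x) retracts the free module onto the kernel of its cover, and [h] lifts this retraction
    through the next cover. On the kernel [h] is a splitting; on the whole free module it serves as
    the contraction. *)
Let extend (n : nat) : splits n ->
  exists h : {linear free_cover (syzygy F n) e -> free_cover (syzygy F n.+1) e},
  forall y : syzygy F n.+1 e,
    cover_map (syzygy F n.+1) e (h (rker_incl (cover_map (syzygy F n)) e y)) = y.
Proof.
move=> [s sK]; pose c : {linear free_cover (syzygy F n) e -> syzygy F n e} :=
  cover_map (syzygy F n) e.
have rZ x : x - s (c x) \in rker_ob (cover_map (syzygy F n)) e.
  apply/kerP; apply: etrans (linearB (cover_map (syzygy F n) e) x (s (c x))) _.
  by rewrite [X in _ - X]sK subrr.
pose r x : syzygy F n.+1 e := Submodule (rZ x).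
have r_lin : linear r.
  move=> a x y; apply: val_inj => /=.
  by rewrite (linearP c) (linearP s) scalerBr opprD addrACA.
pose rl : {linear free_cover (syzygy F n) e -> syzygy F n.+1 e} :=
  HB.pack r (GRing.isLinear.Build _ _ _ _ r r_lin).
have [h hr] := freemod_lift rl (@cover_map_surj R E (syzygy F n.+1) e).
exists h => -[y yZ]; rewrite hr; apply: val_inj => /=.
have /kerP cy := yZ.
by rewrite /c cy linear0 subr0.
Qed.

Lemma splits_all : splits 0 -> forall n, splits n.
Proof.
move=> s0; elim=> [//|n /extend[h hK]].
exists (h \o rker_incl (cover_map (syzygy F n)) e) => x; exact: hK.
Qed.

(** Exactness of Hom_R(-, V) on the resolution for arbitrary V. The extension is [f \o h]: the next
    cover kills h (d x) - x, which is therefore in the image of the next differential, where [f]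
    vanishes. *)
Lemma free_res_extend (n : nat) (V : lmodType R)
    (f : {linear free_cover (syzygy F n.+1) e -> V}) : splits 0 ->
  (forall x, f (free_res_d F n.+1 e x) = 0) ->
  exists g : {linear free_cover (syzygy F n) e -> V},
    forall x, g (free_res_d F n e x) = f x.
Proof.
move=> /splits_all /(_ n)/extend[h hK] fd; exists (f \o h) => x.
pose z := h (free_res_d F n e x) - x.
have cz : cover_map (syzygy F n.+1) e z = 0.
  apply: etrans (linearB (cover_map (syzygy F n.+1) e) _ x) _.
  by rewrite [X in X - _]hK subrr.
have [y ey] := (free_res_im z).1 cz.
have /eqP : f z = 0 by rewrite -ey; apply: fd.
by rewrite (linearB f) subr_eq0 => /eqP.
Qed.

End Splitting.

Lemma const_splits (e : E) : splits (const_rmod R E) e 0.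
Proof.
have [u cu] := @cover_map_surj R E (const_rmod R E) e 1.
have s_lin : linear (fun x : R^o => (x : R) *: u).
  by move=> a x y; rewrite scalerDl scalerA.
pose s : {linear R^o -> free_cover (const_rmod R E) e} :=
  HB.pack (fun x : R^o => (x : R) *: u) (GRing.isLinear.Build _ _ _ _ _ s_lin).
exists s => x; apply: etrans (linearZZ (cover_map (const_rmod R E) e) _ _) _.
by rewrite [X in _ *: X]cu; apply: mulr1.
Qed.

End SplitResolution.

(** * Cochains of the comma categories as products of coinduced modules *)

Section Coinduction.
Variables (R : comPzRingType) (C D : category) (phi : functor C D).
Variable M : coef_system R (nerve C).

Lemma leq_ord_max n (i : 'I_n.+1) : (i <= @ord_max n)%N.
Proof. exact: leq_ord. Qed.

Section Hat.
Variables (n : nat) (s : nerve C n).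

(* The lift of [s] to phi/phi(s_n) given by the morphisms s_i -> s_n. *)
Definition cone_last_ob (i : ordcat n) : comma phi (phi (s ord_max)) :=
  existT _ (s i) (fmap phi (fmap s (leq_ord_max i))).

Fact cone_last_subproof (i j : ordcat n) (ij : Hom i j) :
  comp (projT2 (cone_last_ob j)) (fmap phi (fmap s ij)) =
  projT2 (cone_last_ob i).
Proof.
by rewrite /= -!fmap_comp; congr (fmap phi (fmap s _)); apply: bool_irrelevance.
Qed.

Definition cone_last : nerve (comma phi (phi (s ord_max))) n.
Proof.
refine (@Functor (ordcat n) (comma phi (phi (s ord_max))) cone_last_ob
  (fun i j ij => exist _ (fmap s ij) (cone_last_subproof ij)) _ _).
- by move=> i; apply: eq_exist; apply: fmap_id.
- by move=> i j k g f; apply: eq_exist; apply: fmap_comp.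
Defined.

Lemma cone_lastK : nerve_map (comma_forget phi _) n cone_last = s.
Proof.
by apply: (@functor_ext (ordcat n) C
  (fcomp (comma_forget phi _) cone_last) s (fun=> erefl)).
Qed.

End Hat.

(** The structure map of each vertex of t is that of the last vertex composed with the image under
    phi of t_i -> t_n. Hence t is determined by its image in C and its last structure map. *)
Lemma cone_last_push n (d : D) (t : nerve (comma phi d) n) :
  nerve_map (comma_push phi (projT2 (t ord_max))) n
    (cone_last (nerve_map (comma_forget phi d) n t)) = t.
Proof.
apply: (@functor_to_comma_ext C D phi (ordcat n) d
  (fcomp (comma_push phi (projT2 (t ord_max)))
     (cone_last (nerve_map (comma_forget phi d) n t))) t (fun=> erefl)) => // i.
rewrite /= /comma_push_ob /= (svalP (fmap t (leq_ord_max i))).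
by case: (t i).
Qed.

Lemma comma_coef_eqK n (d : D) (z : gz_ob (comma_coef phi M d) n)
    (t' t : nerve (comma phi d) n) (r : nerve C n)
    (e1 : nerve_map (comma_forget phi d) n t' = r)
    (e2 : r = nerve_map (comma_forget phi d) n t) : t' = t ->
  mmap M (simplices_eq e2) (mmap M (simplices_eq e1) (z t')) = z t.
Proof. by move=> et; subst t' r; rewrite !simplices_eq_id. Qed.

Lemma cone_last_res n (d : D) (z : gz_ob (comma_coef phi M d) n)
    (t : nerve (comma phi d) n) :
  mmap M (simplices_eq (cone_lastK (nerve_map (comma_forget phi d) n t)))
    (comma_res (projT2 (t ord_max)) z
       (cone_last (nerve_map (comma_forget phi d) n t))) = z t.
Proof.
exact (comma_coef_eqK z
  (nerve_comma_push (projT2 (t ord_max))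
     (cone_last (nerve_map (comma_forget phi d) n t)))
  (cone_lastK (nerve_map (comma_forget phi d) n t)) (cone_last_push t)).
Qed.

Variable P : rmod R (op D).
Variable n : nat.

(** The last vertices of [t] and [s] need not be convertible, so the arguments [y] and [y'] have
    different types and are compared as dependent pairs. *)
Lemma coind_transport (l : forall s : nerve C n, P (phi (s ord_max)) -> M (simplex s))
    (t s : nerve C n) (e : t = s)
    (y : P (phi (t ord_max))) (y' : P (phi (s ord_max))) :
  existT (fun c : C => mobj P (phi c)) (t ord_max) y =
    existT (fun c : C => mobj P (phi c)) (s ord_max) y' ->
  mmap M (simplices_eq e) (l t y) = l s y'.
Proof.
subst t => h.
have -> : y = y'.
  by have := projT2_eq h; rewrite (Prop_irrelevance (projT1_eq h) erefl).
exact: simplices_eq_id.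
Qed.

(* Yoneda: [coind] and [coeval] are the two directions of
   Hom(P, C^n) = prod_s Hom_R(P(phi(s_n)), M(s)). *)
Section Coind.
Variable l : forall s : nerve C n, {linear P (phi (s ord_max)) -> M (simplex s)}.

Definition coind_fun (d : op D) (x : P d) : comma_cochains phi M n d :=
  fun t => l (nerve_map (comma_forget phi d) n t)
             (mmap P (projT2 (t ord_max) : @Hom (op D) d _) x).

Fact coind_linear (d : op D) : linear (@coind_fun d).
Proof. by move=> a x y; apply: dprodP => t; rewrite /coind_fun !linearP. Qed.

Fact coind_nat (d' d : op D) (b : Hom d' d) (x : P d') :
  coind_fun (mmap P b x) = mmap (comma_cochains phi M n) b (coind_fun x).
Proof.
apply: dprodP => t; apply: esym.
apply: (@coind_transport (fun s y => l s y) _ _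
  (nerve_comma_push (b : @Hom D d d') t)).
congr existT; exact: (mmap_comp (r := P)).
Qed.

Definition coind : rmod_hom P (comma_cochains phi M n) :=
  RModHom coind_linear coind_nat.

End Coind.

Section Eval.
Variable f : rmod_hom P (comma_cochains phi M n).

Definition coeval (s : nerve C n) (x : P (phi (s ord_max))) : M (simplex s) :=
  mmap M (simplices_eq (cone_lastK s)) (f _ x (cone_last s)).

Fact coeval_linear (s : nerve C n) : linear (@coeval s).
Proof.
move=> a x y; rewrite /coeval -linearP; congr (mmap M _ _).
by rewrite linearP.
Qed.
HB.instance Definition _ (s : nerve C n) :=
  GRing.isLinear.Build R (P (phi (s ord_max))) (M (simplex s)) *:%R
    (@coeval s) (@coeval_linear s).

Lemma coevalE (d : op D) x (t : nerve (comma phi d) n) :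
  f d x t = @coeval (nerve_map (comma_forget phi d) n t)
             (mmap P (projT2 (t ord_max) : @Hom (op D) d _) x).
Proof.
rewrite -[LHS]cone_last_res; congr (mmap M _ _).
exact: (congr1 (fun z : gz_ob _ n => z _) (esym (rhom_nat f _ x))).
Qed.

End Eval.
End Coinduction.

(** * The double complex Hom(P_i, C^j) and its augmentation *)

Section Bicomplex.
Variables (R : comPzRingType) (C D : category) (phi : functor C D).
Variable M : coef_system R (nerve C).

Local Notation F := (const_rmod R (op D)).
Local Notation P := (free_resolution F).

Definition comma_bicomplex i j : lmodType R :=
  rmod_hom (P i) (comma_cochains phi M j).
Local Notation A := comma_bicomplex.

Definition bicomplex_h i j : {linear A i j -> A i.+1 j} := rhom_pre (res_d P i).
Definition bicomplex_v i j : {linear A i j -> A i j.+1} :=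
  rhom_post (comma_d phi M j).
Local Notation dh := bicomplex_h.
Local Notation dv := bicomplex_v.

Lemma bicomplex_hh i j x : dh i.+1 j (dh i j x) = 0.
Proof. exact: (cdd (c := hom_cochain P (comma_cochains phi M j))). Qed.

Lemma bicomplex_vv i j x : dv i j.+1 (dv i j x) = 0.
Proof.
apply: rmod_homP => d u.
exact: (cdd (c := gz_cochain (comma_coef phi M d))).
Qed.

Lemma bicomplex_hv i j x : dh i j.+1 (dv i j x) = dv i.+1 j (dh i j x).
Proof. exact: rmod_homP. Qed.

(** The element z(s) of M(s), seen as a map from R to M(s) and composed with the augmentation of
    P. *)
Definition aug_coind n (z : gz_cochain M n) (s : nerve C n)
  (x : P 0 (phi (s ord_max))) : M (simplex s) := (res_aug P _ x : R) *: z s.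

Fact aug_coind_linear n z s : linear (@aug_coind n z s).
Proof. by move=> a x y; rewrite /aug_coind linearP scalerDl scalerA. Qed.
HB.instance Definition _ n z (s : nerve C n) :=
  GRing.isLinear.Build R (P 0 (phi (s ord_max))) (M (simplex s)) *:%R
    (@aug_coind n z s) (@aug_coind_linear n z s).

Definition bicomplex_eps n (z : gz_cochain M n) : A 0 n :=
  coind (fun s : nerve C n =>
    aug_coind z (s := s) : {linear P 0 (phi (s ord_max)) -> M (simplex s)}).

Lemma bicomplex_epsE n (z : gz_cochain M n) (d : op D) x
    (t : nerve (comma phi d) n) :
  bicomplex_eps z d x t =
  (res_aug P d x : R) *: z (nerve_map (comma_forget phi d) n t).
Proof.
have nat := rhom_nat (res_aug P) (projT2 (t ord_max) : @Hom (op D) d _) x.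
exact (congr1 (fun a : R => a *: z (nerve_map (comma_forget phi d) n t)) nat).
Qed.

Fact bicomplex_eps_linear n : linear (@bicomplex_eps n).
Proof.
move=> a z z'; apply: rmod_homP => d x; apply: dprodP => t.
apply: (etrans (bicomplex_epsE _ x t)).
have -> : (a *: bicomplex_eps z + bicomplex_eps z') d x t =
  a *: bicomplex_eps z d x t + bicomplex_eps z' d x t by [].
rewrite !bicomplex_epsE scalerA mulrC -scalerA -scalerDr.
by [].
Qed.
HB.instance Definition _ n :=
  GRing.isLinear.Build R (gz_cochain M n) (A 0 n) *:%R (@bicomplex_eps n)
    (@bicomplex_eps_linear n).

Lemma bicomplex_eps_d n (z : gz_cochain M n) :
  bicomplex_eps (cd (gz_cochain M) z) = dv 0 n (bicomplex_eps z).
Proof.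
apply: rmod_homP => d x.
pose pull := cosimp_map (gz_pull (nerve_map (comma_forget phi d)) M).
have epsE m (y : gz_cochain M m) :
    bicomplex_eps y d x = (res_aug P d x : R) *: pull m y.
  by apply: dprodP => t; apply: bicomplex_epsE.
apply: (etrans (epsE _ _)).
have dE : dv 0 n (bicomplex_eps z) d x =
  @cd R (gz_cochain (comma_coef phi M d)) n (bicomplex_eps z d x) by [].
by rewrite dE epsE linearZZ cmapd.
Qed.

Lemma bicomplex_h_eps n (z : gz_cochain M n) : dh 0 n (bicomplex_eps z) = 0.
Proof.
apply: rmod_homP => d x; apply: dprodP => t.
have aug0 : res_aug P d (res_d P 0 d x) = 0.
  by apply: (res_exact0 (p := P) _).2; exists x.
by apply: (etrans (bicomplex_epsE z (res_d P 0 d x) t)); rewrite aug0 scale0r.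
Qed.

(** z(s) is recovered by evaluating on an element of augmentation 1 and at the simplex [cone_last],
    which lies over s. *)
Lemma bicomplex_eps_inj n (z : gz_cochain M n) : bicomplex_eps z = 0 -> z = 0.
Proof.
move=> ez; apply: dprodP => s.
have [x augx] := @res_aug_surj R (op D) F P (phi (s ord_max)) (1 : R^o).
have z0 : z (nerve_map (comma_forget phi _) n (cone_last phi s)) = 0.
  have := bicomplex_epsE z x (cone_last phi s).
  by rewrite ez augx scale1r => <-.
have tr r : r = s -> z r = 0 -> z s = 0 by move=> ->.
exact: tr (cone_lastK phi s) z0.
Qed.

Lemma bicomplex_exact0 n (f : A 0 n) : dh 0 n f = 0 -> exists z, bicomplex_eps z = f.
Proof.
move=> df; have fd (d : op D) x : f d (res_d P 0 d x) = 0.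
  exact (congr1 (fun h : A 1 n => h d x) df).
have H (s : nerve C n) : exists v : M (simplex s),
    forall x, coeval f x = (res_aug P (phi (s ord_max)) x : R) *: v.
  (* With [u] of augmentation 1, x minus its augmentation times [u] is a boundary, where [coeval f]
     vanishes. So [coeval f] is the augmentation times its value at [u]. *)
  have [u augu] := @res_aug_surj R (op D) F P (phi (s ord_max)) (1 : R^o).
  exists (coeval f u) => x; pose a : R := res_aug P (phi (s ord_max)) x.
  have aug0 : res_aug P (phi (s ord_max)) (x - a *: u) = 0.
    have augZ : res_aug P _ (a *: u) = a *: res_aug P _ u := linearZZ (res_aug P _) a u.
    apply: (etrans (linearB (res_aug P _) x (a *: u))); rewrite [X in _ - X]augZ augu.
    by rewrite [X in _ - X](mulr1 a : a *: (1 : R^o) = a); apply: subrr.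
  have [y ey] := (res_exact0 (p := P) _).1 aug0.
  have : coeval f (x - a *: u) = 0.
    by rewrite -ey /coeval [f _ _]fd linear0.
  rewrite linearB linearZZ => /eqP; rewrite subr_eq0 => /eqP.
  by [].
pose z : gz_cochain M n := fun s => sval (cid (H s)).
exists z; apply: rmod_homP => d x; apply: dprodP => t.
apply: (etrans (bicomplex_epsE z x t)); apply: esym.
apply: (etrans (coevalE f x t)); rewrite /z; case: cid => v /= ->.
have nat := rhom_nat (res_aug P) (projT2 (t ord_max) : @Hom (op D) d _) x.
exact (congr1 (fun a : R => a *: v) nat).
Qed.

(** [coind] turns any choice of R-linear extensions of the maps [coeval f], one for each s
    independently, into a preimage of [f]. Each extension exists because the resolution splits over
    R at phi(s_n). *)
Lemma bicomplex_exactS i n (f : A i.+1 n) : dh i.+1 n f = 0 -> exists g, dh i n g = f.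
Proof.
move=> df.
have fd (d : op D) x : f d (res_d P i.+1 d x) = 0.
  exact (congr1 (fun h : A i.+2 n => h d x) df).
have H (s : nerve C n) : exists g : {linear P i (phi (s ord_max)) -> M (simplex s)},
    forall x, g (res_d P i _ x) = coeval f x.
  apply: (@free_res_extend R (op D) F (phi (s ord_max)) i (M (simplex s))
    (@coeval R C D phi M (P i.+1) n f s) (@const_splits R (op D) _)) => x.
  exact (etrans (congr1 (fun z : gz_ob (comma_coef phi M _) n =>
    mmap M (simplices_eq (cone_lastK phi s)) (z (cone_last phi s))) (fd _ x))
    (linear0 _)).
exists (coind (fun s => sval (cid (H s)))).
apply: rmod_homP => d x; apply: dprodP => t.
apply: esym; apply: (etrans (coevalE f x t)); rewrite -(svalP (cid (H _))).
have nat := rhom_nat (res_d P i) (projT2 (t ord_max) : @Hom (op D) d _) x.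
exact (congr1 (sval (cid (H (nerve_map (comma_forget phi d) n t)))) nat).
Qed.

End Bicomplex.

Theorem theorem5p2 (R : comPzRingType) (C D : category) (phi : functor C D)
    (M : coef_system R (nerve C)) :
  exists S : spectral_sequence R,
    [/\ first_quadrant S,
        forall p q : nat,
          inhabited (lin_iso (S 2%N p q) (cat_cohomology p (Hth_comma phi M q))) &
        converges S (fun n => Hth M n)].
Proof.
pose P := free_resolution (const_rmod R (op D)).
pose A := comma_bicomplex phi M.
pose dh i j : {linear A i j -> A i.+1 j} := bicomplex_h phi M i j.
pose dv i j : {linear A i j -> A i j.+1} := bicomplex_v phi M i j.
pose dhh := @bicomplex_hh R C D phi M.
pose dvv := @bicomplex_vv R C D phi M.
pose dhv := @bicomplex_hv R C D phi M.
exists (@tot_ss R A dh dv dhh dvv dhv); split.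
- exact: tot_ss_first_quadrant.
- move=> p q; constructor.
  (* The last function is compatibility with the horizontal differentials: these precompose with
     [res_d] on both sides, so it suffices to evaluate [fg] at [res_d P p d x]. *)
  exact (@second_page_iso R A dh dv dhh dvv dhv
    (fun q => hom_cochain P (Hth_comma phi M q))
    (fun p q => @represents R C D phi M (P p) q)
    (fun p q => @represents_linear R C D phi M (P p) q)
    (fun p q => @represents_closed R C D phi M (P p) q)
    (fun p q => @represents_exists R C D phi M (P p) q)
    (fun p q => @represents_lift R C D phi M (syzygy (const_rmod R (op D)) p) q)
    (fun p q =>
       @represents_boundary R C D phi M (syzygy (const_rmod R (op D)) p) q)
    (fun p q f g fg d x => fg d (res_d P p d x)) p q).
- exact (@tot_ss_converges R A dh dv dhh dvv dhv (gz_cochain M)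
    (fun n => @bicomplex_eps R C D phi M n)
    (@bicomplex_eps_d R C D phi M) (@bicomplex_h_eps R C D phi M)
    (@bicomplex_eps_inj R C D phi M) (@bicomplex_exact0 R C D phi M)
    (@bicomplex_exactS R C D phi M)).
Qed.
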